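(* Let $C_p(E,Q)$ be the $C$-polynomial and $A_p(L,M)$ the $A$-polynomial of the twist knot $K_p$, and let $\phi:\mathbb Q(E,Q)\to\mathbb Q(L,M)$ be the map given by $$\phi(E)=\frac{L(M^2-1)^2}{M(L+M)(1+LM)},\qquad \phi(Q)=\frac{1+LM}{L+M}.$$ (a) For every $p\in\mathbb Z$, $$\phi\, C_p^{\mathrm{op}}(E,Q)=A_p(L,M^{1/2})\cdot\begin{cases}\dfrac{(1+LM)^p}{M^p(L+M)^{3p-1}} & \text{if } p>0,\\[3mm] \dfrac{1}{(M(L+M)(1+LM))^{|p|}} & \text{if } p\le0.\end{cases}$$ (b) For every $p\neq0$, $C_p(E,Q)$ is irreducible over $\mathbb Q$ (in $\mathbb Q[E,Q]$ for $p>0$; for $p<0$, where negative powers of $Q$ occur, in $\mathbb Q[E,Q^{\pm1}]$).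
   Context: **Operators.** A discrete function is a map $f:\mathbb N=\{0,1,2,\dots\}\to\mathbb Q(q)$. Operators act by $(Ef)(n)=f(n+1)$, $(Qf)(n)=q^nf(n)$, so $EQ=qQE$. Let $\mathcal A=\mathbb Q(q)\langle Q,E\rangle/(EQ-qQE)$ and $\mathcal A_{\mathrm{loc}}=\mathbb Q(q,Q)\langle E\rangle/(E\alpha(Q,q)-\alpha(qQ,q)E\mid\alpha\in\mathbb Q(Q,q))$, a (left) principal ideal domain. For a discrete function $f$ let $I_f=\{P\in\mathcal A\mid Pf=0\}$. The characteristic polynomial of $f$ is a generator $P_f(E,Q,q)$ of the left ideal of $\mathcal A_{\mathrm{loc}}$ generated by $I_f$ (unique up to left multiplication by a nonzero element of $\mathbb Q(q,Q)$). **$C$-polynomial.** For a knot $K$, $J_K(n)\in\mathbb Z[q^{\pm1}]$ ($n\ge1$) is the colored Jones function (color: the $n$-dimensional irreducible representation of $\mathfrak{sl}_2$; value $1$ on the unknot). The cyclotomic function $\hat J_K:\mathbb N\to\mathbb Z[q^{\pm1}]$ is determined by $J_K(n)=\sum_{k\ge0}C(n,k)\hat J_K(k)$ for $n\ge1$, with $C(n,k)=\{n-k\}\cdots\{n-1\}\{n+1\}\cdots\{n+k\}$, $\{a\}=q^{a/2}-q^{-a/2}$. The non-commutative $C$-polynomial $C_K(E,Q,q)$ is the characteristic polynomial of $\hat J_K$, and the $C$-polynomial is $C_K(E,Q)=C_K(E,Q,1)$. For twist knots the non-commutative $C$-polynomial is normalized to be monic in $E$; it then has coefficients in $\mathbb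 Z[Q^{\pm1},q^{\pm1}]$. **Twist knots.** $K_p$ ($p\in\mathbb Z$) is the twist knot with $p$ full twists and a negative clasp; $K_0$ is the unknot, $K_1=3_1$, $K_2=5_2$, $K_{-1}=4_1$, $K_{-2}=6_1$. It is known (Masbaum) that its cyclotomic function is $$\hat J_p(n)=\sum_{k=0}^{n}q^{n(n+3)/2+pk(k+1)+k(k-1)/2}(-1)^{n+k+1}\frac{(q^{2k+1}-1)(q;q)_n}{(q;q)_{n+k+1}(q;q)_{n-k}},$$ with $(q;q)_m=(1-q)\cdots(1-q^m)$ and $(q;q)_0=1$. For a polynomial $P(E,Q)$ in $E$, $P^{\mathrm{op}}(E,Q)=E^{\deg_EP}P(E^{-1},Q)$. **$A$-polynomial.** The $A$-polynomial $A_K(L,M)\in\mathbb Z[L,M]$ (Cooper–Culler–Gillet–Long–Shalen) is the primitive polynomial without repeated factors whose zero set is the closure of the one-dimensional part of the set of eigenvalue pairs $(L,M)$ (longitude, meridian, common eigenvector) of $\mathrm{SL}_2(\mathbb C)$ representations of the knot group, with the factor $L-1$ coming from abelian representations removed. It contains only even powers of $M$, so $A_K(L,M^{1/2})$ is a polynomial in $L,M$. For $K_p$ the conventions (including sign) are those of Hoste–Shanahan: $A_0=1$, $A_1=L+M^6$, $A_{-1}=-L+LM^2+M^4+2LM^4+L^2M^4+LM^6-LM^8$, $A_2=-L^2+L^3+2L^2M^2+LM^4+2L^2M^4-LM^6-L^2M^8+2LM^{10}+L^2M^{10}+2LM^{12}+M^{14}-LM^{14}$, and for $p\ge3$ or $p\le-2$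 $$A_p=x\,A_{p-\mathrm{sgn}(p)}-y\,A_{p-2\,\mathrm{sgn}(p)},$$ $$x=-L+L^2+2LM^2+M^4+2LM^4+L^2M^4+2LM^6+M^8-LM^8,\qquad y=M^4(L+M^2)^4 .$$ It is also known (Hoste–Shanahan) that $A_p$ is irreducible for $p\neq 0$. *)

(* Defs.v *)
From HB Require Import structures.
From mathcomp Require Import all_boot all_order all_algebra.
From mathcomp Require Import fraction generic_quotient.

Set Implicit Arguments.
Unset Strict Implicit.
Unset Printing Implicit Defensive.

Import Order.TTheory GRing.Theory Num.Theory.
Local Open Scope ring_scope.

(* Rational functions over the rationals in one variable, and in two
   variables as the iterated field Q(x)(y).  The pair (inner variable x,
   outer variable y) is (q, Q), (Q, E) or (M, L). *)
Definition ratfun1 := {fraction {poly rat}}.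
Definition ratfun2 := {fraction {poly ratfun1}}.

Definition var1 : ratfun1 := tofrac 'X.
Definition inner : ratfun2 := tofrac var1%:P.
Definition outer : ratfun2 := tofrac 'X.

Definition ofZ1 (c : {poly int}) : ratfun1 := tofrac (map_poly intr c).
Definition ofZ2 (r : {poly {poly int}}) : ratfun2 := tofrac (map_poly ofZ1 r).

(* Extension of g to fractions, computed on the chosen representative n/d.
   When g is an injective ring morphism, this is the unique field morphism
   extending g; it is only used in that case. *)
Definition frac_ext (R : idomainType) (K : fieldType) (g : R -> K)
    (x : {fraction R}) : K :=
  let r : {ratio R} := repr x in g (\n_r) / g (\d_r).

Definition subst1 (u : ratfun2) : ratfun1 -> ratfun2 :=
  frac_ext (fun c : {poly rat} => (map_poly ratr c).[u]).

(* The substitution (inner, outer) := (u, v), for algebraically independent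
   u and v. *)
Definition subst2 (u v : ratfun2) : ratfun2 -> ratfun2 :=
  frac_ext (fun c : {poly ratfun1} => (map_poly (subst1 u) c).[v]).

(* An element of the q-Weyl algebra A is written uniquely as
   \sum_j a_j(Q) E^j with a_j in Q(q)[Q]; an element of its localization
   A_loc uniquely as \sum_j a_j(Q) E^j with a_j in Q(q, Q).  These normal
   forms are polynomials in the outer variable E; the product of A_loc is
   skew_mul below, not the commutative one of {poly _}. *)
Definition qWeyl := {poly {poly ratfun1}}.
Definition qWeyl_loc := {poly ratfun2}.

Definition act (P : qWeyl) (f : nat -> ratfun1) (n : nat) : ratfun1 :=
  \sum_(j < size P) (P`_j).[var1 ^+ n] * f (n + j)%N.

Definition annihilator (f : nat -> ratfun1) (P : qWeyl) : Prop :=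
  forall n, act P f n = 0.

Definition loc (P : qWeyl) : qWeyl_loc :=
  map_poly (@tofrac _) P.

(* a(Q, q) |-> a(qQ, q), so that E a = (qshift a) E *)
Definition qshift : ratfun2 -> ratfun2 := subst2 inner (inner * outer).

Definition skew_mul (A B : qWeyl_loc) : qWeyl_loc :=
  \sum_(i < size A) \sum_(j < size B)
    (A`_i * iter i qshift B`_j) *: 'X^(i + j).

Inductive left_ideal (S : qWeyl_loc -> Prop) : qWeyl_loc -> Prop :=
| left_ideal0 : left_ideal S 0
| left_idealD (A B T : qWeyl_loc) :
    S B -> left_ideal S T -> left_ideal S (skew_mul A B + T).

Definition characteristic_poly (f : nat -> ratfun1) (P : qWeyl_loc) : Prop :=
  forall T : qWeyl_loc,
    left_ideal (fun B => exists2 A, annihilator f A & B = loc A) T <->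
    exists A, T = skew_mul A P.

Definition qpoch (m : nat) : ratfun1 := \prod_(1 <= i < m.+1) (1 - var1 ^+ i).

(* The cyclotomic function of the twist knot K_p, by Masbaum's formula. *)
Definition cyclotomic (p : int) (n : nat) : ratfun1 :=
  \sum_(0 <= k < n.+1)
    var1 ^ (((n * (n + 3))./2)%:Z + p * (k * k.+1)%:Z + ((k * k.-1)./2)%:Z)
    * (-1) ^+ (n + k).+1
    * ((var1 ^+ (2 * k).+1 - 1) * qpoch n / (qpoch (n + k).+1 * qpoch (n - k))).

(* a lies in Z[Q^{+-1}, q^{+-1}] and specializes at q = 1 to b in
   Z[Q^{+-1}]. *)
Definition specializes_q1 (a : ratfun2) (b : ratfun1) : Prop :=
  exists (N : nat) (r : {poly {poly int}}),
    a = ofZ2 r / (inner * outer) ^+ N /\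
    b = ofZ1 (map_poly (fun c : {poly int} => c.[1]) r) / var1 ^+ N.

(* C(E, Q), as a polynomial in E over Q(Q), is the C-polynomial of K_p. *)
Definition C_polynomial (p : int) (C : {poly ratfun1}) : Prop :=
  exists P : qWeyl_loc,
    [/\ P \is monic,
        characteristic_poly (cyclotomic p) P
      & forall j, specializes_q1 P`_j C`_j].

(* C^op(E, Q) = E^(deg C) C(1/E, Q) *)
Definition op (C : {poly ratfun1}) : {poly ratfun1} :=
  \poly_(j < size C) C`_((size C).-1 - j).

(* The A-polynomials A_p(L, M) of the twist knots, in the normalization of
   Hoste and Shanahan; L is the outer variable and M the inner one. *)
Section HosteShanahan.
Let L : {poly {poly int}} := 'X.
Let M : {poly {poly int}} := 'X%:P.

Definition HSx : {poly {poly int}} :=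
  - L + L^+2 + 2 * L * M^+2 + M^+4 + 2 * L * M^+4 + L^+2 * M^+4
  + 2 * L * M^+6 + M^+8 - L * M^+8.

Definition HSy : {poly {poly int}} := M^+4 * (L + M^+2)^+4.

Fixpoint Apoly_pos (n : nat) : {poly {poly int}} :=
  match n with
  | 0 => 1
  | 1 => L + M^+6
  | 2 => - L^+2 + L^+3 + 2 * L^+2 * M^+2 + L * M^+4 + 2 * L^+2 * M^+4
         - L * M^+6 - L^+2 * M^+8 + 2 * L * M^+10 + L^+2 * M^+10
         + 2 * L * M^+12 + M^+14 - L * M^+14
  | (n2.+1 as n1).+1 => HSx * Apoly_pos n1 - HSy * Apoly_pos n2
  end.

Fixpoint Apoly_neg (n : nat) : {poly {poly int}} :=
  match n with
  | 0 => 1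
  | 1 => - L + L * M^+2 + M^+4 + 2 * L * M^+4 + L^+2 * M^+4 + L * M^+6
         - L * M^+8
  | (n2.+1 as n1).+1 => HSx * Apoly_neg n1 - HSy * Apoly_neg n2
  end.

Definition Apoly (p : int) : {poly {poly int}} :=
  match p with
  | Posz n => Apoly_pos n
  | Negz n => Apoly_neg n.+1
  end.
End HosteShanahan.

(* A_p(L, M^(1/2)): since A_p has only even powers of M, halving the
   exponents of M amounts to taking the even part of each coefficient. *)
Definition Apoly_sqrt (p : int) : {poly {poly int}} :=
  map_poly (fun c : {poly int} => even_poly c) (Apoly p).

Definition phi : ratfun2 -> ratfun2 :=
  let L := outer in
  let M := inner in
  subst2 ((1 + L * M) / (L + M))
         (L * (M ^+ 2 - 1) ^+ 2 / (M * (L + M) * (1 + L * M))).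

(* The subrings Q[E, Q] and Q[E, Q^{+-1}] of Q(Q)[E]. *)
Definition polyEQ (C : {poly ratfun1}) : Prop :=
  exists c : {poly {poly rat}},
    C = map_poly (@tofrac _) c.

Definition laurentEQ (C : {poly ratfun1}) : Prop :=
  exists N : nat, polyEQ (var1 ^+ N *: C).

Definition unit_in (R : comNzRingType) (S : R -> Prop) (x : R) : Prop :=
  S x /\ exists2 y, S y & x * y = 1.

Definition irreducible_in (R : comNzRingType) (S : R -> Prop) (x : R) : Prop :=
  [/\ S x, x <> 0, ~ unit_in S x
    & forall a b, S a -> S b -> x = a * b -> unit_in S a \/ unit_in S b].

(* Main.v *)
(* Put Z = q^N, z = q^k, lam = q z + 1/z.  In Masbaum's formula the shift
   n |-> n - 1 acts on the k-th term as multiplication by a polynomial of degree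
   1 in lam, so an operator of order |p| acts as a polynomial of degree |p| in
   lam, written in a Newton basis.  The polynomial
     ((q Z z)^p (z - Z) (1 - q z) + (Z / z)^p (1 - q Z z) (1 - z)) / (q z^2 - 1)
   makes the sum over k telescope.  It satisfies a three-term recurrence in p
   with polynomial coefficients, whence the integrality of its coordinates.  At
   q = 1 this recurrence becomes the Hoste-Shanahan one under phi, and the
   polynomial becomes -Z^p (T_p(lam) - Z T_(p-1)(lam)) for Chebyshev-like
   coprime polynomials T_p: it is linear in Z, hence irreducible.  By Gauss'
   lemma at q - 1 the operator itself is irreducible in A_loc, so it generates
   the annihilator unless the cyclotomic function is eventually zero; that is
   impossible, since the recurrence could then be run backwards down to the
   value 1 at n = 0. *)
Require Import Defs.
From HB Require Import structures.
From mathcomp Require Import all_boot all_order all_algebra.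
From mathcomp Require Import fraction generic_quotient.
From mathcomp Require Import ring.

Set Implicit Arguments.
Unset Strict Implicit.
Unset Printing Implicit Defensive.

Import Order.TTheory GRing.Theory Num.Theory.
Local Open Scope ring_scope.

(** * Fraction fields *)

(** The denominator [q z^2 - 1] is the factor [q^(2k+1) - 1] of Masbaum's summand and cancels
    against it. The numbers [q Z z] and [Z / z] are the roots of [x^2 - Z lam x + q Z^2]; they are
    exchanged by [z -> 1/(q z)], which fixes [lam]. Their cofactors are such that, multiplied by the
    summand, one exponential gives [G(k)] and the other [-G(k+1)]. The first Newton coordinate is
    [Z - 1] for every p, and each later coefficient of the recurrence also contains the factor
    [1 - Z]; dividing by [Z - 1] makes the operator monic and creates no denominator. The prime
    [q - 1] is the right one for Gauss' lemma because the shift [Q -> q Q] is trivial modulo it: a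
    product in A_loc specializes to a commutative product. There, linearity in Z means
    [Z = T_p / T_(p-1)], a rational function of degree |p| in lam, so lam has degree |p| over Q(Z);
    at q = 1, [1/E] is an affine function of lam over Q(Z), hence has the same degree. The main
    technical obstacle is that substitutions, evaluations and specializations live on iterated
    fraction fields, where morphisms need transcendence proofs and specializations are only
    partial. *)

Section FractionExtension.
Variables (R : idomainType) (K : fieldType).

Lemma frac_eta (x : {fraction R}) :
  x = tofrac (\n_(repr x)) / tofrac (\d_(repr x)).
Proof.
have dn0 : \d_(repr x) != 0 := denom_ratioP (repr x).
rewrite -{1}[x](@reprK _ {fraction R}) -{1}[repr x]Ratio_numden.
move: (\n_(repr x)) (\d_(repr x)) dn0 => n d dn0.
apply: (canRL (mulfK _)); first by rewrite tofrac_eq0.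
unlock FracField.tofrac; rewrite -[LHS]FracField.pi_mul.
apply/eqmodP/eqP; rewrite /= !numden_Ratio ?mulf_neq0 ?oner_eq0 //.
by rewrite !mulr1 mulrC.
Qed.

Lemma frac_ind (P : {fraction R} -> Prop) :
  (forall n d, d != 0 -> P (tofrac n / tofrac d)) -> forall x, P x.
Proof. by move=> h x; rewrite [x]frac_eta; apply/h/denom_ratioP. Qed.

Variable g : {rmorphism R -> K}.
Hypothesis g_inj : forall x, g x = 0 -> x = 0.

(** Cross-multiplying [n / d] with the chosen representative gives an identity in [R]; applying [g]
    shows that the choice does not matter. Injectivity keeps the denominators nonzero. *)
Lemma frac_ext_div n d : d != 0 ->
  frac_ext g (tofrac n / tofrac d) = g n / g d.
Proof.
have gn0 y : y != 0 -> g y != 0 by apply: contra => /eqP/g_inj ->.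
move=> dn0; set x := tofrac n / tofrac d; rewrite /frac_ext.
have rn0 : \d_(repr x) != 0 := denom_ratioP (repr x).
have /eqP := frac_eta x.
rewrite [in X in X == _]/x eqr_div ?tofrac_eq0 // -!tofracM tofrac_eq => /eqP e.
by apply/eqP; rewrite eqr_div ?gn0 // -!rmorphM e.
Qed.

Lemma frac_ext_tofrac n : frac_ext g (tofrac n) = g n.
Proof.
by rewrite -[tofrac n]divr1 -tofrac1 frac_ext_div ?oner_eq0 // rmorph1 divr1.
Qed.

Fact frac_ext_is_zmod_morphism : zmod_morphism (frac_ext g).
Proof.
have gn0 y : y != 0 -> g y != 0 by apply: contra => /eqP/g_inj ->.
elim/frac_ind=> n d dn0; elim/frac_ind=> m e en0.
rewrite -mulNr addf_div ?tofrac_eq0 // -tofracN -!tofracM -tofracD.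
rewrite !frac_ext_div ?mulf_neq0 // -mulNr addf_div ?gn0 //.
by rewrite rmorphD !rmorphM rmorphN.
Qed.

Fact frac_ext_is_monoid_morphism : monoid_morphism (frac_ext g).
Proof.
split; first by rewrite -tofrac1 frac_ext_tofrac rmorph1.
elim/frac_ind=> n d dn0; elim/frac_ind=> m e en0.
rewrite mulf_div -!tofracM !frac_ext_div ?mulf_neq0 //.
by rewrite mulf_div !rmorphM.
Qed.

(* Opaque on purpose: unfolding this morphism makes unification of terms of
   [ratfun2] intractable. *)
Fact frac_ext_morph_key :
  {f : {rmorphism {fraction R} -> K} | f =1 frac_ext g}.
Proof.
pose f : {rmorphism {fraction R} -> K} := HB.pack (frac_ext g)
    (GRing.isZmodMorphism.Build _ _ (frac_ext g) frac_ext_is_zmod_morphism)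
    (GRing.isMonoidMorphism.Build _ _ (frac_ext g) frac_ext_is_monoid_morphism).
by exists f.
Qed.

Definition frac_ext_morph := sval frac_ext_morph_key.

Lemma frac_ext_morphE : frac_ext g =1 frac_ext_morph.
Proof. by move=> x; rewrite (svalP frac_ext_morph_key). Qed.

Lemma frac_ext_morph_tofrac n : frac_ext_morph (tofrac n) = g n.
Proof. by rewrite -frac_ext_morphE frac_ext_tofrac. Qed.

End FractionExtension.

Lemma tofrac_inj (R : idomainType) : injective (@tofrac R).
Proof. by move=> x y /eqP; rewrite tofrac_eq => /eqP. Qed.

Lemma map_tofrac_inj (R : idomainType) : injective (map_poly (@tofrac R)).
Proof. exact: (map_inj_poly (@tofrac_inj R) (@tofrac0 R)). Qed.

(** Stated for an embedding [h] because [ratfun2], built as an iterated fraction field, must also be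
    read as the fraction field of the two-variable polynomials [{poly {poly rat}}]. *)
Definition is_frac_field (R : idomainType) (K : fieldType) (h : R -> K) :=
  (forall x, h x = 0 -> x = 0) /\ forall y, exists r d, d != 0 /\ y = h r / h d.

Lemma is_frac_field_tofrac (R : idomainType) :
  is_frac_field (@tofrac R : R -> {fraction R}).
Proof.
split=> [x /eqP|]; first by rewrite tofrac_eq0 => /eqP.
by elim/frac_ind=> n d dn0; exists n, d.
Qed.

Lemma clear_denominators (R : idomainType) (K : fieldType)
    (h : {rmorphism R -> K}) (A : {poly K}) :
  is_frac_field h ->
  exists d (B : {poly R}), d != 0 /\ h d *: A = map_poly h B.
Proof.
case=> h_inj h_frac.
elim/poly_ind: A => [|A c [d [B [dn0 eB]]]].
  by exists 1, 0; rewrite oner_neq0 scaler0 rmorph0.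
have [r [e [en0 ->]]] := h_frac c.
have hen0 : h e != 0 by apply: contra en0 => /eqP/h_inj->.
exists (d * e), (e *: B * 'X + (d * r)%:P); rewrite mulf_neq0 //; split=> //.
rewrite rmorphD /= [map_poly h (_ * _)]rmorphM /= map_polyZ map_polyX map_polyC /= -eB.
rewrite -!mul_polyC mulrDr -polyCM; congr (_ + _%:P).
  by rewrite rmorphM polyCM; ring.
by rewrite !rmorphM; field.
Qed.

Lemma is_frac_field_poly (R : idomainType) (K : fieldType)
    (h : {rmorphism R -> K}) :
  is_frac_field h -> is_frac_field (@tofrac {poly K} \o map_poly h).
Proof.
move=> hh; have [h_inj _] := hh.
have mh_inj (p : {poly R}) : map_poly h p = 0 -> p = 0.
  move=> e; apply/polyP=> i; rewrite coef0; apply: h_inj.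
  by rewrite -coef_map e coef0.
split=> [x /= /eqP|]; first by rewrite tofrac_eq0 => /eqP/mh_inj.
elim/frac_ind=> n d dn0 /=.
have [a [n' [an0 en]]] := clear_denominators n hh.
have [b [d' [bn0 ed]]] := clear_denominators d hh.
have hn0 x : x != 0 -> h x != 0 by apply: contra => /eqP/h_inj->.
have d'n0 : d' != 0.
  apply: contra dn0 => /eqP d0; move: ed; rewrite d0 rmorph0 => /eqP.
  by rewrite scaler_eq0 (negPf (hn0 _ bn0)).
exists (b *: n'), (a *: d'); split.
  by rewrite -mul_polyC mulf_neq0 // polyC_eq0.
have bn : map_poly h (b *: n') = (h a * h b) *: n.
  by rewrite map_polyZ -en scalerA mulrC.
have ad : map_poly h (a *: d') = (h a * h b) *: d.
  by rewrite map_polyZ -ed scalerA.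
rewrite bn ad -![(h a * h b) *: _]mul_polyC !tofracM invfM mulrACA divff ?mul1r //.
by rewrite tofrac_eq0 polyC_eq0 mulf_neq0 ?hn0.
Qed.

Definition iota2 : {poly {poly rat}} -> ratfun2 :=
  @tofrac {poly ratfun1} \o map_poly (@tofrac {poly rat}).
HB.instance Definition _ := GRing.RMorphism.copy iota2
  (@tofrac {poly ratfun1} \o map_poly (@tofrac {poly rat})).

Lemma is_frac_field_iota2 : is_frac_field iota2.
Proof. exact/is_frac_field_poly/is_frac_field_tofrac. Qed.

Lemma iota2_eq0 r : (iota2 r == 0) = (r == 0).
Proof.
apply/eqP/eqP=> [|->]; last exact: rmorph0.
exact: (proj1 is_frac_field_iota2).
Qed.

(** * Substitutions in rational functions *)

Lemma div_expr_mul (K : fieldType) (x y : K) i s :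
  y != 0 -> (i <= s)%N -> (x / y) ^+ i * y ^+ s = x ^+ i * y ^+ (s - i).
Proof.
move=> yn0 le_is; rewrite -{1}(subnKC le_is) exprD expr_div_n -mulrA.
by rewrite mulKf // expf_neq0.
Qed.

Lemma homogenize (R : idomainType) (A : {poly R}) (x y : R) n :
  y != 0 -> (size A <= n.+1)%N ->
  (map_poly (@tofrac R) A).[tofrac x / tofrac y] * tofrac y ^+ n
  = tofrac (\sum_(i < n.+1) A`_i * (x ^+ i * y ^+ (n - i))).
Proof.
move=> yn0 sA.
rewrite (@horner_coef_wide _ n.+1); last exact: leq_trans (size_poly _ _) sA.
rewrite mulr_suml rmorph_sum; apply: eq_bigr => i _ /=.
rewrite coef_map /= !tofracM !tofracXn -mulrA div_expr_mul ?tofrac_eq0 //.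
by rewrite -ltnS.
Qed.

Section Ratio.
Variable k : fieldType.

(** The fraction [n / d] has a pole at [t]: in the homogenized relation, evaluation at [t] kills
    every term except the leading one. *)
Lemma ratio_transcendental (n d : {poly k}) (t : k) (a : {poly k}) :
  d != 0 -> d.[t] = 0 -> n.[t] != 0 ->
  (map_poly (@tofrac {poly k} \o polyC) a).[tofrac n / tofrac d] = 0 ->
  a = 0.
Proof.
move=> dn0 dt nt; apply: contra_eq => an0; set s := (size a).-1.
have sE : size a = s.+1 by rewrite /s prednK // lt0n size_poly_eq0.
have sP : (size (map_poly polyC a) <= s.+1)%N.
  by rewrite size_map_polyC sE.
apply/negP => /eqP e0; have := homogenize n dn0 sP.
rewrite -map_poly_comp e0 mul0r => /esym/eqP; rewrite tofrac_eq0.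
move=> /eqP/(congr1 (horner_eval t)); rewrite rmorph0 /horner_eval horner_sum.
rewrite big_ord_recr /= big1 ?add0r => [|i _].
  rewrite subnn mulr1 coef_map hornerM hornerC horner_exp => /eqP.
  by rewrite mulf_eq0 expf_eq0 (negPf nt) andbF orbF -[a`_s]/(lead_coef a)
             lead_coef_eq0 (negPf an0).
rewrite !hornerM [(d ^+ _).[t]]horner_exp dt expr0n subn_eq0 leqNgt ltn_ord.
by rewrite /= !mulr0.
Qed.

End Ratio.

Definition cst : ratfun1 -> ratfun2 := @tofrac {poly ratfun1} \o polyC.
HB.instance Definition _ :=
  GRing.RMorphism.copy cst (@tofrac {poly ratfun1} \o polyC).
Definition kap : rat -> ratfun1 := @tofrac {poly rat} \o polyC.
HB.instance Definition _ :=
  GRing.RMorphism.copy kap (@tofrac {poly rat} \o polyC).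

Lemma ratr_cst : (@ratr ratfun2) =1 cst \o kap.
Proof. by move=> x; rewrite -(fmorph_eq_rat (cst \o kap)). Qed.

Section Substitution.
Variables u v : ratfun2.

Definition eval1 : {rmorphism {poly rat} -> ratfun2} :=
  horner_eval u \o map_poly (cst \o kap).

Hypothesis u_transc : forall c, eval1 c = 0 -> c = 0.

Definition subst1m := frac_ext_morph u_transc.

Lemma subst1E : subst1 u =1 subst1m.
Proof.
move=> x; rewrite -frac_ext_morphE /subst1 /frac_ext.
by rewrite !(eq_map_poly ratr_cst).
Qed.

Definition eval2 : {rmorphism {poly ratfun1} -> ratfun2} :=
  horner_eval v \o map_poly subst1m.

Hypothesis v_transc : forall c, eval2 c = 0 -> c = 0.

Definition subst2m := frac_ext_morph v_transc.

Lemma subst2E : subst2 u v =1 subst2m.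
Proof.
move=> x; rewrite -frac_ext_morphE /subst2 /frac_ext.
by rewrite !(eq_map_poly subst1E).
Qed.

Lemma subst1m_var1 : subst1m var1 = u.
Proof.
by rewrite [LHS](frac_ext_morph_tofrac u_transc) /eval1 /= map_polyX /horner_eval hornerX.
Qed.

Lemma subst2m_cst x : subst2m (cst x) = subst1m x.
Proof.
by rewrite [LHS](frac_ext_morph_tofrac v_transc) /eval2 /= map_polyC /horner_eval hornerC.
Qed.

Lemma subst2m_inner : subst2m inner = u.
Proof. by rewrite -subst1m_var1 -subst2m_cst. Qed.

Lemma subst2m_tofrac c : subst2m (tofrac c) = (map_poly subst1m c).[v].
Proof. exact: (frac_ext_morph_tofrac v_transc). Qed.

End Substitution.

Lemma var1_neq0 : var1 != 0.
Proof. by rewrite tofrac_eq0 polyX_eq0. Qed.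

Lemma inner_neq0 : inner != 0.
Proof. by rewrite tofrac_eq0 polyC_eq0 var1_neq0. Qed.

Lemma outer_neq0 : outer != 0.
Proof. by rewrite tofrac_eq0 polyX_eq0. Qed.

Lemma horner_var1 c : (map_poly kap c).[var1] = tofrac c.
Proof.
rewrite -[kap]/(@tofrac {poly rat} \o polyC) map_poly_comp.
by rewrite horner_map /= -/(comp_poly _ _) comp_polyXr.
Qed.

Lemma horner_outer c w :
  (map_poly cst c).[tofrac w] = tofrac (c \Po w).
Proof.
by rewrite -[cst]/(@tofrac {poly ratfun1} \o polyC) map_poly_comp horner_map.
Qed.

Lemma eval1_inner c : eval1 inner c = cst (tofrac c).
Proof.
by rewrite /eval1 /= map_poly_comp /horner_eval -[inner]/(cst var1) horner_map
           horner_var1.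
Qed.

Lemma inner_transc c : eval1 inner c = 0 -> c = 0.
Proof.
by rewrite eval1_inner => /eqP; rewrite fmorph_eq0 tofrac_eq0 => /eqP.
Qed.

Lemma subst1m_inner : subst1m inner_transc =1 cst.
Proof.
elim/frac_ind=> n d dn0.
by rewrite !fmorph_div /subst1m !frac_ext_morph_tofrac !eval1_inner.
Qed.

Lemma qshift_transc c :
  eval2 (inner * outer) inner_transc c = 0 -> c = 0.
Proof.
rewrite -[eval2 _ _ c]/((map_poly (subst1m inner_transc) c).[inner * outer]).
rewrite (eq_map_poly subst1m_inner) -tofracM horner_outer => /eqP.
rewrite tofrac_eq0 comp_poly2_eq0 => [/eqP//|].
by rewrite mul_polyC size_scale ?var1_neq0 // size_polyX.
Qed.

Definition qshiftm := subst2m qshift_transc.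

Lemma qshiftE : qshift =1 qshiftm.
Proof. exact: subst2E. Qed.

Lemma qshiftm_tofrac c : qshiftm (tofrac c) = tofrac (c \Po (var1%:P * 'X)).
Proof.
by rewrite /qshiftm subst2m_tofrac (eq_map_poly subst1m_inner) -tofracM
           horner_outer.
Qed.

Lemma qshiftm_inner : qshiftm inner = inner.
Proof. exact: subst2m_inner. Qed.

Definition phiQ : ratfun2 := (1 + outer * inner) / (outer + inner).
Definition phiE : ratfun2 :=
  outer * (inner ^+ 2 - 1) ^+ 2
  / (inner * (outer + inner) * (1 + outer * inner)).

(** As a function of L over Q(M), [phiQ] has a pole at L = -M, where its numerator is 1 - M^2. *)
Lemma Mobius_transc (a : {poly ratfun1}) :
  (map_poly cst a).[phiQ] = 0 -> a = 0.
Proof.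
have -> : phiQ = tofrac (1 + 'X * var1%:P) / tofrac ('X + var1%:P).
  by rewrite rmorphD rmorph1 rmorphM rmorphD.
apply: (@ratio_transcendental _ _ _ (- var1)).
- by rewrite -size_poly_gt0 size_XaddC.
- by rewrite !hornerE addNr.
rewrite !hornerE mulNr -expr2 subr_eq0 eq_sym -subr_eq0.
rewrite -rmorphXn -tofrac1 -tofracB tofrac_eq0 -size_poly_gt0.
by rewrite size_XnsubC.
Qed.

Lemma phiQ_transc c : eval1 phiQ c = 0 -> c = 0.
Proof.
rewrite /eval1 /= map_poly_comp /horner_eval => /Mobius_transc/eqP.
by rewrite map_poly_eq0 => /eqP.
Qed.

Definition mu : ratfun1 := tofrac ('X^2 + 1) / var1.

Lemma mu_transc (c : {poly rat}) : (map_poly kap c).[mu] = 0 -> c = 0.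
Proof.
apply: (@ratio_transcendental _ _ _ 0); first by rewrite polyX_eq0.
  by rewrite hornerX.
by rewrite hornerD hornerXn hornerC expr0n add0r oner_eq0.
Qed.

Lemma add_outer_inner_neq0 : outer + inner != 0.
Proof. by rewrite -tofracD tofrac_eq0 -size_poly_gt0 size_XaddC. Qed.

Lemma one_add_mul_neq0 : 1 + outer * inner != 0.
Proof.
rewrite -tofracM -tofrac1 -tofracD tofrac_eq0 -size_poly_gt0.
rewrite addrC mulrC mul_polyC size_polyDl size_scale ?var1_neq0 // size_polyX //.
by rewrite size_poly1.
Qed.

Lemma Mobius_trace (K : fieldType) (L M : K) :
  M != 0 -> L + M != 0 -> 1 + L * M != 0 ->
  L * (M ^+ 2 - 1) ^+ 2 / (M * (L + M) * (1 + L * M))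
  + ((1 + L * M) / (L + M) + ((1 + L * M) / (L + M))^-1) = M + M^-1.
Proof. by move=> Mn0 LMn0 nn0; field; rewrite Mn0 LMn0 nn0. Qed.

Lemma phi_trace : phiE + (phiQ + phiQ^-1) = cst mu.
Proof.
have -> : cst mu = inner + inner^-1.
  rewrite /mu tofracD tofracXn tofrac1 -/var1 mulrDl mul1r expr2.
  by rewrite mulfK ?var1_neq0 // rmorphD fmorphV.
exact: (Mobius_trace inner_neq0 add_outer_inner_neq0 one_add_mul_neq0).
Qed.

Lemma swapXY_map_kap (c : {poly {poly rat}}) (x : ratfun1) i :
  ((map_poly (map_poly kap) c).[x%:P])`_i = (map_poly kap (swapXY c)`_i).[x].
Proof.
by rewrite horner_polyC swapXY_map coef_map /horner_eval coef_map.
Qed.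

Lemma eval1E (u : ratfun2) c :
  eval1 u c = horner_eval u (map_poly cst (map_poly kap c)).
Proof. by rewrite -map_poly_comp. Qed.

Lemma horner_swap_cst (u : ratfun2) (c : {poly {poly ratfun1}}) x :
  (map_poly cst c.[x%:P]).[u]
  = (map_poly (horner_eval u \o map_poly cst) c).[cst x].
Proof.
have -> : cst x = (horner_eval u \o map_poly cst) x%:P.
  by rewrite /= map_polyC /horner_eval hornerC.
exact: (esym (horner_map (horner_eval u \o map_poly cst) _ _)).
Qed.

(* phiE + phiQ + 1/phiQ = M + 1/M lies in Q(M) and phiQ is a Moebius function
   of L over Q(M). *)
Lemma phi_transc c : eval2 phiE phiQ_transc c = 0 -> c = 0.
Proof.
rewrite -[eval2 _ _ c]/((map_poly (subst1m phiQ_transc) c).[phiE]).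
have: forall x, subst1m phiQ_transc (tofrac x) = eval1 phiQ x.
  exact: (frac_ext_morph_tofrac phiQ_transc).
move: (subst1m phiQ_transc) (subst1m_var1 phiQ_transc) => sg sg_var1 sg_tofrac.
pose w : ratfun1 := var1 + var1^-1.
have sgw : sg w = phiQ + phiQ^-1.
  by rewrite /w rmorphD fmorphV sg_var1.
(* Translating E by [Q + 1/Q] replaces the value [phiE] by M + 1/M, which no longer involves L. *)
pose c1 := c \Po ('X - w%:P).
have -> : c = c1 \Po ('X + w%:P).
  by rewrite /c1 -comp_polyA comp_polyB comp_polyX comp_polyC addrK comp_polyXr.
have mapE : map_poly sg ('X + w%:P) = 'X + (phiQ + phiQ^-1)%:P.
  by rewrite rmorphD /= map_polyX map_polyC /= sgw.
rewrite map_comp_poly mapE.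
rewrite horner_comp hornerD hornerX hornerC
  phi_trace => e1.
suff -> : c1 = 0 by rewrite comp_poly0.
have [d [c2 [dn0 ec2]]] := clear_denominators c1 (is_frac_field_tofrac _).
suff c20 : c2 = 0.
  move/eqP: ec2; rewrite c20 rmorph0 scaler_eq0 tofrac_eq0 (negPf dn0).
  by move/eqP.
have {}e1 : (map_poly sg (map_poly (@tofrac _) c2)).[cst mu] = 0.
  by rewrite -ec2 map_polyZ hornerZ e1 mulr0.
(* With Q as main variable, the coefficients are polynomials in the translated E: [Mobius_transc]
   makes their values at [mu] vanish, and [mu_transc] then the coefficients themselves. *)
suff /eqP : swapXY c2 = 0 by rewrite swapXY_eq0 => /eqP.
apply/polyP=> i; rewrite coef0; apply: mu_transc.
rewrite -swapXY_map_kap.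
suff -> : (map_poly (map_poly kap) c2).[mu%:P] = 0 by rewrite coef0.
apply: Mobius_transc.
rewrite horner_swap_cst.
rewrite -[RHS]e1 -!map_poly_comp; congr (_.[_]); apply: eq_map_poly => x /=.
by rewrite sg_tofrac eval1E.
Qed.

Definition phim := subst2m phi_transc.

Lemma phimE : phi =1 phim.
Proof. exact: subst2E. Qed.

(** * Coefficients of the recurrence *)

Section IntRecurrence.
Variable K : fieldType.

(** As [c] is invertible, the recurrence also runs backwards. Closed forms valid for all integers p
    are obtained this way from p = 0 and p = 1. *)
Lemma int_rec_uniq (a c : K) (x y : int -> K) :
  c != 0 ->
  (forall p, x (p + 1) = a * x p - c * x (p - 1)) ->
  (forall p, y (p + 1) = a * y p - c * y (p - 1)) ->
  x 0 = y 0 -> x 1 = y 1 -> x =1 y.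
Proof.
move=> cn0 rx ry e0 e1.
have pos (n : nat) : x n = y n /\ x n.+1 = y n.+1.
  elim: n => [//|n [IH IH1]]; split=> //.
  by rewrite -[n.+2]addn1 PoszD rx ry IH1 -[n.+1]addn1 PoszD addrK IH.
have neg (n : nat) : x (- n%:Z) = y (- n%:Z) /\ x (- n%:Z + 1) = y (- n%:Z + 1).
  elim: n => [|n [IH IH1]]; first by rewrite oppr0 add0r.
  have -> : - n.+1%:Z = - n%:Z - 1 by rewrite -addn1 PoszD opprD.
  rewrite subrK; split=> //; apply: (mulfI cn0).
  by move: (rx (- n%:Z)) (ry (- n%:Z)); rewrite IH IH1 => -> /addrI/oppr_inj ->.
by case=> n; [case: (pos n) | rewrite NegzE; case: (neg n.+1)].
Qed.

End IntRecurrence.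

Section Coefficients.
Variables (K : fieldType) (q Z : K).

(* With Z = q^N, z = q^k and lam = q z + 1/z, [bcoef p m] is the coordinate on
   [eps m] (the Newton basis below) of the polynomial in lam
     ((q Z z)^p (z - Z) (1 - q z) + (Z / z)^p (1 - q Z z) (1 - z)) / (q z^2 - 1).
   As a function of p it satisfies x (p + 1) = Z lam x p - q Z^2 x (p - 1), and
   [bstep] is multiplication by Z lam in coordinates. *)
Definition bstep (b : nat -> K) (m : nat) : K :=
  (q ^+ m + Z ^+ 2 * q / q ^+ m) * b m + (if m is m'.+1 then q * Z * b m' else 0).

Definition bpair (b0 b1 : K) (m : nat) : K :=
  match m with 0 => b0 | 1 => b1 | _ => 0 end.

Fixpoint bpos (n : nat) : nat -> K :=
  match n with
  | 0 => bpair (Z - 1) 0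
  | 1 => bpair (Z - 1) (- (q * Z))
  | (n2.+1 as n1).+1 => fun m => bstep (bpos n1) m - q * Z ^+ 2 * bpos n2 m
  end.

Fixpoint bneg (n : nat) : nat -> K :=
  match n with
  | 0 => bpair (Z - 1) 0
  | 1 => bpair (Z - 1) 1
  | (n2.+1 as n1).+1 => fun m => (bstep (bneg n1) m - bneg n2 m) / (q * Z ^+ 2)
  end.

Definition bcoef (p : int) : nat -> K :=
  match p with Posz n => bpos n | Negz n => bneg n.+1 end.

Hypotheses (q0 : q != 0) (Z0 : Z != 0).

Lemma bcoef_rec p m :
  bcoef (p + 1) m = bstep (bcoef p) m - q * Z ^+ 2 * bcoef (p - 1) m.
Proof.
case: p => [[|n]|[|n]].
- rewrite add0r sub0r -[- 1]/(Negz 0) /bcoef /= /bstep.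
  by case: m => [|[|[|m]]] /=; field; rewrite ?(oner_neq0, expf_neq0, q0).
- have -> : Posz n.+1 + 1 = n.+2 by rewrite -[n.+2]addn1 PoszD.
  by have -> : Posz n.+1 - 1 = n by rewrite -[n.+1]addn1 PoszD addrK.
- have -> : Negz 0 + 1 = Posz 0 by [].
  have -> : Negz 0 - 1 = Negz 1 by [].
  by rewrite /bcoef /=; field; rewrite q0 Z0.
have -> : Negz n.+1 + 1 = Negz n by rewrite !NegzE -addn1 PoszD opprD subrK.
have -> : Negz n.+1 - 1 = Negz n.+2 by rewrite !NegzE -[n.+3]addn1 PoszD opprD.
by rewrite /bcoef /=; field; rewrite q0 Z0.
Qed.

Lemma bstepS b m :
  bstep b m.+1 = (q ^+ m.+1 + Z ^+ 2 * q / q ^+ m.+1) * b m.+1 + q * Z * b m.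
Proof. by []. Qed.

Lemma bposSS n m :
  bpos n.+2 m = bstep (bpos n.+1) m - q * Z ^+ 2 * bpos n m.
Proof. by []. Qed.

Lemma bnegSS n m :
  bneg n.+2 m = (bstep (bneg n.+1) m - bneg n m) / (q * Z ^+ 2).
Proof. by []. Qed.

Lemma bpos_eq0 n m : (n < m)%N -> bpos n m = 0.
Proof.
elim/ltn_ind: n m => [[|[|n]]] IH [|[|m]] // lt_nm.
have ltn1 : (n.+1 < m.+2)%N := ltnW lt_nm.
by rewrite bposSS bstepS !IH ?mulr0 ?subr0 ?addr0 //; apply: ltnW.
Qed.

Lemma bneg_eq0 n m : (n < m)%N -> bneg n m = 0.
Proof.
elim/ltn_ind: n m => [[|[|n]]] IH [|[|m]] // lt_nm.
have ltn1 : (n.+1 < m.+2)%N := ltnW lt_nm.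
by rewrite bnegSS bstepS !IH ?mulr0 ?subr0 ?addr0 ?mul0r //; apply: ltnW.
Qed.

Lemma bcoef_eq0 p m : (`|p| < m)%N -> bcoef p m = 0.
Proof. by case: p => n; [apply: bpos_eq0 | apply: bneg_eq0]. Qed.

(** At m = 0 the recurrence has coefficients [1 + q Z^2] and [q Z^2], whose difference is 1, so
    constants solve it. *)
Lemma bcoef0 p : bcoef p 0 = Z - 1.
Proof.
pose a := 1 + Z ^+ 2 * q.
apply: (@int_rec_uniq K a (q * Z ^+ 2) (bcoef ^~ 0%N) (fun=> Z - 1)) => //.
- by rewrite mulf_neq0 // expf_neq0.
- by move=> i; rewrite bcoef_rec /bstep expr0 divr1 addr0.
by move=> i; rewrite /a; ring.
Qed.

Lemma bcoef_last p : bcoef p `|p|%N = 0 -> p = 0.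
Proof.
have pos n : bpos n.+1 n.+1 != 0.
  elim: n => [|n IH]; first by rewrite /= oppr_eq0 mulf_neq0.
  rewrite bposSS bstepS (@bpos_eq0 n.+1 n.+2) // (@bpos_eq0 n n.+2) //.
  by rewrite !mulr0 subr0 add0r !mulf_neq0.
have neg n : bneg n.+1 n.+1 != 0.
  elim: n => [|n IH]; first by rewrite /= oner_neq0.
  rewrite bnegSS bstepS (@bneg_eq0 n.+1 n.+2) // (@bneg_eq0 n n.+2) // !mulr0 subr0 add0r !mulf_neq0 //.
  by rewrite invr_eq0 mulf_neq0 ?expf_neq0.
by case: p => [[|n]|n] //= /eqP; [rewrite (negPf (pos n)) | rewrite (negPf (neg n))].
Qed.

(* Up to a scalar, [eps m] is the product of (1 - q^(N-j) / z) (1 - q^(N-j+1) z)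
   over j < m. *)
Variables (lam : K) (eps : nat -> K).
Hypothesis eps0 : eps 0%N = 1.
Hypothesis epsS : forall m,
  q * Z * eps m.+1 = (Z * lam - q ^+ m - Z ^+ 2 * q / q ^+ m) * eps m.

Definition Phi (p : int) : K := \sum_(m < `|p|.+1) bcoef p m * eps m.

Lemma Phi_wide p M : (`|p| < M)%N -> Phi p = \sum_(m < M) bcoef p m * eps m.
Proof.
move=> ltM; rewrite -(subnKC ltM) big_split_ord /= [X in _ + X]big1 ?addr0 //.
by move=> i _; rewrite bcoef_eq0 ?mul0r //; apply: leq_addr.
Qed.

(** By [epsS], [Z lam] sends [eps m] to [q Z eps (m+1)] plus [q^m + Z^2 q / q^m] times [eps m];
    [bstep] collects these coordinates. The vanishing of [b M] leaves room for the increase of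
    degree. *)
Lemma sum_bstep b M : b M = 0 ->
  \sum_(m < M.+1) bstep b m * eps m = Z * lam * \sum_(m < M) b m * eps m.
Proof.
move=> bM0.
have e i : bstep b i * eps i = Z * lam * (b i * eps i)
    - q * Z * (b i * eps i.+1) + (if i is j.+1 then q * Z * (b j * eps i) else 0).
  rewrite /bstep mulrDl; case: i => [|i].
    by rewrite !mul0r; ring: (epsS 0).
  by ring: (epsS i.+1).
under eq_bigr => i _ do rewrite e.
rewrite !big_split /= -mulr_sumr big_ord_recr /= bM0 mul0r addr0 -addrA.
rewrite [X in _ + X](_ : _ = 0) ?addr0 //.
rewrite big_ord_recr /= bM0 mul0r mulr0 oppr0 addr0 big_ord_recl /= add0r.
by rewrite -big_split big1 //= => i _; rewrite addNr.
Qed.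

Lemma Phi_rec p : Phi (p + 1) = Z * lam * Phi p - q * Z ^+ 2 * Phi (p - 1).
Proof.
have lt3 (e : int) : `|e| = 1 -> (`|(p + e)%R| < `|p|.+3)%N.
  move=> e1; rewrite -ltz_nat abszE; apply: le_lt_trans (ler_normD _ _) _.
  by rewrite e1 -abszE -PoszD addn1 ltz_nat.
rewrite (@Phi_wide (p + 1) `|p|.+3) ?(@Phi_wide (p - 1) `|p|.+3) ?lt3 //.
rewrite (@Phi_wide p `|p|.+2) // -sum_bstep ?bcoef_eq0 // mulr_sumr -sumrB.
by apply: eq_bigr => m _; rewrite bcoef_rec mulrBl mulrA.
Qed.

Lemma Phi0 : Phi 0 = Z - 1.
Proof. by rewrite /Phi big_ord1 /= eps0 mulr1. Qed.

Lemma Phi1 : Phi 1 = Z * (1 + q * Z - lam).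
Proof.
rewrite /Phi big_ord_recl big_ord1 /= eps0 mulr1 mulNr epsS eps0 expr0.
by field; rewrite oner_neq0.
Qed.

(** [q Z z] and [Z / z] have sum [Z lam] and product [q Z^2], so the right side obeys the recurrence
    of [Phi_rec]; only p = 0 and p = 1 remain to be compared. *)
Lemma Phi_closed z p : z != 0 -> lam = q * z + z^-1 ->
  Phi p * (q * z ^+ 2 - 1)
  = (q * Z * z) ^ p * (z - Z) * (1 - q * z)
    + (Z / z) ^ p * (1 - q * Z * z) * (1 - z).
Proof.
move=> z0 lamE.
have cn0 : q * Z ^+ 2 != 0 by rewrite mulf_neq0 // expf_neq0.
pose y p := (q * Z * z) ^ p * (z - Z) * (1 - q * z)
    + (Z / z) ^ p * (1 - q * Z * z) * (1 - z).
have n1 : q * Z * z != 0 by rewrite !mulf_neq0.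
have n2 : Z / z != 0 by rewrite mulf_neq0 // invr_eq0.
apply: (@int_rec_uniq K (Z * lam) (q * Z ^+ 2)
          (fun p => Phi p * (q * z ^+ 2 - 1)) y) => //.
- by move=> i; rewrite Phi_rec; ring.
- move=> i; rewrite /y !expfzDr // !expr1z lamE; set u := _ ^ i; set v := _ ^ i.
  by rewrite !exprN1; field; rewrite q0 Z0 z0.
- by rewrite Phi0 /y !expr0z; ring.
by rewrite Phi1 /y !expr1z lamE; field.
Qed.

End Coefficients.

(** * Creative telescoping *)

Section Telescoping.
Variables (K : fieldType) (q : K).
Hypotheses (q0 : q != 0) (q_nroot : forall i, (0 < i)%N -> 1 - q ^+ i != 0).

Definition qfact (m : nat) : K := \prod_(1 <= i < m.+1) (1 - q ^+ i).

(** Masbaum's sum over an abstract field in which [q] is not a root of unity; at [var1] it is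
    [cyclotomic] by conversion. *)
Definition cyc (p : int) (n : nat) : K :=
  \sum_(0 <= k < n.+1)
    q ^ (((n * (n + 3))./2)%:Z + p * (k * k.+1)%:Z + ((k * k.-1)./2)%:Z)
    * (-1) ^+ (n + k).+1
    * ((q ^+ (2 * k).+1 - 1) * qfact n / (qfact (n + k).+1 * qfact (n - k))).

Lemma qfact0 : qfact 0 = 1.
Proof. by rewrite /qfact big_geq. Qed.

Lemma qfactS m : qfact m.+1 = qfact m * (1 - q ^+ m.+1).
Proof. by rewrite /qfact big_nat_recr. Qed.

Lemma qfact_neq0 m : qfact m != 0.
Proof.
by elim: m => [|m IH]; rewrite ?qfact0 ?oner_neq0 // qfactS mulf_neq0 ?q_nroot.
Qed.

Lemma cyc0 p : cyc p 0 = 1.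
Proof.
have e1 : qfact 1 = 1 - q by rewrite qfactS qfact0 mul1r expr1.
have n1 : 1 - q != 0 by rewrite -[q]expr1 q_nroot.
by rewrite /cyc big_nat1 /= mulr0 !addr0 e1 qfact0 expr0z; field; rewrite n1.
Qed.

Lemma half_triS n : (n.+1 * (n.+1 + 3))./2 = ((n * (n + 3))./2 + n.+2)%N.
Proof.
have -> : (n.+1 * (n.+1 + 3) = n * (n + 3) + n.+2.*2)%N.
  by rewrite -addnn; ring.
by rewrite halfD odd_double andbF add0n doubleK.
Qed.

Lemma half_binS k : (k.+1 * k)./2 = ((k * k.-1)./2 + k)%N.
Proof.
case: k => [//|k].
have -> : (k.+2 * k.+1 = k.+1 * k + k.+1.*2)%N by rewrite -addnn; ring.
by rewrite halfD odd_double andbF add0n doubleK.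
Qed.

Variables (p : int) (N : nat).
Let Z := q ^+ N.

Definition eps_at (k m : nat) : K :=
  \prod_(0 <= j < m) ((q * q ^+ k + (q ^+ k)^-1) / q - q ^+ j / q / Z - Z / q ^+ j).

Let qn0 n : q ^+ n != 0. Proof. by rewrite expf_neq0. Qed.

Lemma eps_atS k m : q * Z * eps_at k m.+1 =
  (Z * (q * q ^+ k + (q ^+ k)^-1) - q ^+ m - Z ^+ 2 * q / q ^+ m) * eps_at k m.
Proof.
rewrite /eps_at big_nat_recr //=; set P := \prod_(_ <= _ < _) _.
by field; rewrite ?q0 ?qn0.
Qed.

(** The two factors on the right are [1 - q^(n+1-k)] and [1 - q^(n+k+2)], the quotients of
    successive q-factorials in the denominator of Masbaum's term. *)
Lemma eps_at_factor k m n : (n + m.+1 = N)%N ->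
  (q * q ^+ k + (q ^+ k)^-1) / q - q ^+ m / q / Z - Z / q ^+ m
  = - (1 - q ^+ n.+1 / q ^+ k) * (1 - q ^+ n.+1 * q * q ^+ k) / (q ^+ n.+1 * q).
Proof.
move=> eN; have -> : Z = q ^+ n.+1 * q ^+ m by rewrite /Z -eN -exprD addSnnS.
by field; rewrite ?q0 ?qn0.
Qed.

(** The factor of index j = N - k is zero. Hence the sums for all shifts n = N - m can share the
    range k <= N, although Masbaum's sum stops at n. *)
Lemma eps_at_small k m : (k <= N)%N -> (N - k < m)%N -> eps_at k m = 0.
Proof.
move=> le_kN lt_m; rewrite /eps_at (bigD1_seq (N - k)%N) ?iota_uniq //=; last first.
  by rewrite mem_index_iota.
have -> : Z = q ^+ (N - k) * q ^+ k by rewrite /Z -exprD subnK.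
by set x := _ - _; have -> : x = 0; rewrite ?mul0r // /x; field; rewrite ?q0 ?qn0.
Qed.

Definition summand (k : nat) : K :=
  q ^ (p * (k * k.+1)%:Z + ((k * k.-1)./2)%:Z) * (-1) ^+ k
  * (q ^+ (2 * k).+1 - 1) / (qfact (N + k).+1 * qfact (N - k)).

Definition weight (k n : nat) : K :=
  (-1) ^+ n * q ^+ (n * (n + 3))./2 / (qfact (n + k).+1 * qfact (n - k)).

(* Moving the shift n |-> n - 1 of Masbaum's sum into its k-th term multiplies
   that term by a Newton basis factor. *)
Lemma weight_shift k m n : (n + m = N)%N -> (k <= n)%N ->
  weight k n = eps_at k m * weight k N.
Proof.
elim: m n => [|m IH] n eN le_kn.
  by rewrite /eps_at big_geq // mul1r -eN addn0.
have eN' : (n.+1 + m = N)%N by rewrite addSnnS.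
rewrite /eps_at big_nat_recr //= -/(eps_at k m) mulrAC -(IH n.+1) //; last exact: leqW.
rewrite (eps_at_factor k eN) /weight half_triS subSn // addSn (qfactS (n + k).+1) (qfactS (n - k)).
have -> : q ^+ (n + k).+2 = q ^+ n.+1 * q * q ^+ k.
  by rewrite -exprSr -exprD; congr (_ ^+ _); rewrite !addSn.
have -> : q ^+ (n - k).+1 = q ^+ n.+1 / q ^+ k.
  by rewrite -subSn // expfB.
have -> : q ^+ ((n * (n + 3))./2 + n.+2) = q ^+ (n * (n + 3))./2 * (q ^+ n.+1 * q).
  by rewrite exprD exprSr.
have n1 : 1 - q ^+ n.+1 * q * q ^+ k != 0.
  by rewrite -exprSr -exprD q_nroot.
have n2 : 1 - q ^+ n.+1 / q ^+ k != 0.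
  have -> : q ^+ n.+1 / q ^+ k = q ^+ (n.+1 - k).
    by rewrite expfB.
  by rewrite q_nroot // subn_gt0 ltnS.
move: (qfact_neq0 (n + k).+1) (qfact_neq0 (n - k)) (qn0 n.+1) n1 n2 (qn0 k).
move: (qfact _) (qfact _) (q ^+ n.+1) (q ^+ k) => A B x y.
move=> A0 B0 x0 n1 n2 y0; rewrite [(-1) ^+ n.+1]exprS.
have n3 : y - x != 0.
  by apply: contra n2; rewrite subr_eq0 => /eqP->; rewrite divff // subrr.
by field; rewrite A0 B0 x0 n1 y0 q0 n3.
Qed.

Lemma cyc_shift n m : (n + m = N)%N ->
  cyc p n = (-1) ^+ N.+1 * q ^+ (N * (N + 3))./2 * qfact n
            * \sum_(0 <= k < N.+1) eps_at k m * summand k.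
Proof.
move=> eN; have le_nN : (n <= N)%N by rewrite -eN leq_addr.
rewrite (big_cat_nat _ (n := n.+1)) //= [X in _ + X]big_nat_cond.
rewrite [X in _ + X]big1 => [|k /andP[/andP[lt_nk lt_kN] _]]; last first.
  by rewrite eps_at_small ?mul0r // ltn_subLR // -{1}eN ltn_add2r.
rewrite addr0 mulr_sumr /cyc; apply: eq_big_nat => k /andP[_ lt_kn].
have := weight_shift eN (lt_kn : (k <= n)%N).
rewrite /weight /summand => W.
transitivity (q ^ (p * (k * k.+1)%:Z + ((k * k.-1)./2)%:Z) * - (-1) ^+ k
  * (q ^+ (2 * k).+1 - 1) * qfact n * 
  ((-1) ^+ n * q ^+ (n * (n + 3))./2 / (qfact (n + k).+1 * qfact (n - k)))).
  rewrite -addrA expfzDr // -exprnP [(-1) ^+ _.+1]exprS exprD.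
  by rewrite !invfM; ring.
by rewrite W [(-1) ^+ N.+1]exprS invfM; ring.
Qed.

(* G(0) = 0 kills one boundary term; at k = N the factor z - Z kills the
   other. *)
Definition cert (k : nat) : K :=
  (-1) ^+ k * Z ^ p * q ^ (p * (k * k)%:Z + ((k * k.-1)./2)%:Z) * (1 - q ^+ k)
  / (qfact (N + k) * qfact (N - k)).

Lemma summand_Phi k : summand k * Phi q Z (eps_at k) p =
  q ^ (p * (k * k)%:Z) * q ^+ ((k * k.-1)./2) * (-1) ^+ k * Z ^ p *
  (q ^ p * (q ^ (p * k%:Z)) ^+ 2 * (q ^+ k - Z) * (1 - q * q ^+ k)
   + (1 - q * Z * q ^+ k) * (1 - q ^+ k)) / (qfact (N + k).+1 * qfact (N - k)).
Proof.
have eps0 : eps_at k 0 = 1 by rewrite /eps_at big_geq.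
have := Phi_closed q0 (qn0 N) eps0 (@eps_atS k) p (qn0 k) erefl.
have e1 : q ^+ (2 * k).+1 = q * (q ^+ k) ^+ 2 by rewrite exprS -exprM mulnC.
have e2 : (q ^+ k) ^ p = q ^ (p * k%:Z) by rewrite exprnP exprzAC exprz_exp.
have e3 : q ^ (p * (k * k.+1)%:Z) = q ^ (p * (k * k)%:Z) * q ^ (p * k%:Z).
  by rewrite -expfzDr // -mulrDr -PoszD mulnS addnC.
have e4 : (q * Z * q ^+ k) ^ p = q ^ p * Z ^ p * q ^ (p * k%:Z).
  by rewrite !expfzMl; congr (_ * _).
have e5 : (Z / q ^+ k) ^ p = Z ^ p / q ^ (p * k%:Z).
  by rewrite expfzMl exprz_inv -invr_expz; congr (_ * _^-1).
rewrite e4 e5 -/Z; set w := Phi _ _ _ _ => cl.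
have u0 : q ^ (p * k%:Z) != 0 by rewrite expfz_neq0.
move: (qfact_neq0 (N + k).+1) (qfact_neq0 (N - k)) => A0 B0.
rewrite /summand e1 expfzDr // e3 -exprnP.
transitivity (q ^ (p * (k * k)%:Z) * q ^+ ((k * k.-1)./2) * (-1) ^+ k
   * q ^ (p * k%:Z) * (w * (q * (q ^+ k) ^+ 2 - 1))
   / (qfact (N + k).+1 * qfact (N - k))); first by ring.
by rewrite cl; field; rewrite A0 B0 u0.
Qed.

(** In [summand_Phi], the product with [(1 - q Z z)(1 - z)] is [cert k]. The other is [- cert k.+1]:
    there [1 - q^(N-k) = (z - Z) / z], and the [1 / z] is absorbed by the growth of the triangular
    exponent. *)
Lemma cert_step k : (k < N)%N ->
  summand k * Phi q Z (eps_at k) p = cert k - cert k.+1.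
Proof.
move=> lt_kN; rewrite summand_Phi /cert.
have e1 : q ^+ (N + k).+1 = q * Z * q ^+ k by rewrite exprS exprD mulrA.
have e2 : q ^+ (N - k) = Z / q ^+ k by rewrite expfB.
have e3 : q ^ (p * (k.+1 * k.+1)%:Z)
  = q ^ (p * (k * k)%:Z) * (q ^ (p * k%:Z)) ^+ 2 * q ^ p.
  rewrite expr2 -!expfzDr //; congr (_ ^ _).
  by rewrite !PoszM -addn1 PoszD; ring.
have n1 : 1 - q * Z * q ^+ k != 0 by rewrite -e1 q_nroot.
have n2 : 1 - Z / q ^+ k != 0 by rewrite -e2 q_nroot // subn_gt0.
have n3 : q ^+ k - Z != 0.
  apply: contra n2; rewrite subr_eq0 => /eqP <-.
  by rewrite divff ?subrr // qn0.
rewrite -(subnSK lt_kN) !expfzDr // e3 addnS /= half_binS !qfactS subnSK // e1 e2.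
rewrite -!exprnP [(-1) ^+ k.+1]exprS [q ^+ (_ + k)]exprD [q ^+ k.+1]exprS.
move: (qfact_neq0 (N + k)) (qfact_neq0 (N - k.+1)) n1 n2 n3 (qn0 k).
move=> A0 B0 n1 n2 n3 y0.
by field; rewrite A0 B0 n1 n3 y0.
Qed.

(** Separate from [cert_step] because the truncated subtraction in [cert N.+1] would not give the
    value 0 that the pattern requires. *)
Lemma cert_last : summand N * Phi q Z (eps_at N) p = cert N.
Proof.
rewrite summand_Phi /cert subrr mulr0 mul0r add0r subnn qfact0 !mulr1 qfactS.
have e1 : q ^+ (N + N).+1 = q * Z * Z by rewrite exprS exprD mulrA.
have n1 : 1 - q * Z * Z != 0 by rewrite -e1 q_nroot.
rewrite e1 !expfzDr // -!exprnP -/Z.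
move: (qfact_neq0 (N + N)) => A0.
by field; rewrite A0 n1.
Qed.

Lemma sum_summand : \sum_(0 <= k < N.+1) summand k * Phi q Z (eps_at k) p = 0.
Proof.
rewrite big_nat_recr //= cert_last.
rewrite (eq_big_nat _ _ (fun k h => cert_step (proj2 (andP h)))).
rewrite (@telescope_sumr_eq _ 0 N (fun k => - cert k)) // => [|k _].
  by rewrite /cert expr0 subrr mulr0 mul0r oppr0 subr0 addNr.
by rewrite opprK addrC.
Qed.

(** The prefactor [qfact n] of [cyc_shift] depends on the shift. The product built into the
    coefficients of the recurrence turns it into the common factor [qfact N]. *)
Lemma prod_qfact m : (m <= N)%N ->
  \prod_(0 <= j < m) (1 - Z / q ^+ j) * qfact (N - m) = qfact N.
Proof.
elim: m => [|m IH] lt_mN; first by rewrite big_geq // mul1r subn0.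
rewrite big_nat_recr //= -IH ?(ltnW lt_mN) // -mulrA; congr (_ * _).
by rewrite -(subnSK lt_mN) qfactS mulrC subnSK // expfB.
Qed.

Lemma cyc_annihilated : (`|p| <= N)%N ->
  \sum_(m < `|p|.+1) bcoef q Z p m * \prod_(0 <= j < m) (1 - Z / q ^+ j)
     * cyc p (N - m) = 0.
Proof.
move=> le_pN.
transitivity ((-1) ^+ N.+1 * q ^+ (N * (N + 3))./2 * qfact N
  * \sum_(0 <= k < N.+1) summand k * Phi q Z (eps_at k) p).
  rewrite [in RHS]mulr_sumr.
  under [RHS]eq_bigr => k _ do rewrite /Phi !mulr_sumr.
  rewrite exchange_big /=; apply: eq_bigr => m _.
  have le_mN : (m <= N)%N by apply: leq_trans le_pN; rewrite -ltnS.
  rewrite (cyc_shift (subnK le_mN)) -(prod_qfact le_mN) !mulr_sumr.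
  by apply: eq_bigr => k _; ring.
by rewrite sum_summand mulr0.
Qed.

End Telescoping.

(** * The polynomial at q = 1 *)

Section CommutativePolynomial.
Variables (K : fieldType) (q Z : K).

(** The coefficient in [cyc_annihilated] divided by [Z - 1]: for m = 0 it is [bcoef p 0 = Z - 1],
    for m > 0 the factor j = 0 of the product is [1 - Z], whence the sign and the product from j =
    1. *)
Definition ccoef (p : int) (m : nat) : K :=
  if m == 0%N then 1 else - bcoef q Z p m * \prod_(1 <= j < m) (1 - Z / q ^+ j).

(* Z stands for q^N with N = n + |p|: the coefficient of E^(|p| - m) multiplies
   the value at N - m. *)
Definition Cpoly (p : int) : {poly K} :=
  \poly_(i < `|p|.+1) ccoef p (`|p| - i)%N.

Lemma ccoef_bcoef p m : q != 0 -> Z != 0 ->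
  (Z - 1) * ccoef p m = bcoef q Z p m * \prod_(0 <= j < m) (1 - Z / q ^+ j).
Proof.
move=> q0 Z0; rewrite /ccoef; case: m => [|m] /=.
  by rewrite big_geq // !mulr1 bcoef0.
by rewrite [in RHS]big_ltn // expr0; field; rewrite oner_neq0.
Qed.

Lemma size_Cpoly p : size (Cpoly p) = `|p|.+1.
Proof. by apply: size_poly_eq; rewrite subnn oner_neq0. Qed.

Lemma Cpoly_monic p : Cpoly p \is monic.
Proof. by rewrite monicE lead_coefE size_Cpoly coef_poly ltnSn subnn. Qed.

End CommutativePolynomial.

(* Specializations are only partially defined on fraction fields; they are
   handled as relations compatible with the ring operations. *)
Definition ring_rel (R S : pzRingType) (r : R -> S -> Prop) :=
  [/\ r 1 1,
      forall a b a' b', r a b -> r a' b' -> r (a - a') (b - b')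
    & forall a b a' b', r a b -> r a' b' -> r (a * a') (b * b')].

Section RingRelations.
Variables (R S : pzRingType) (r : R -> S -> Prop).
Hypothesis rr : ring_rel r.

Lemma rel1 : r 1 1. Proof. by case: rr. Qed.
Lemma relB a b a' b' : r a b -> r a' b' -> r (a - a') (b - b').
Proof. by case: rr => _ + _; apply. Qed.
Lemma relM a b a' b' : r a b -> r a' b' -> r (a * a') (b * b').
Proof. by case: rr => _ _; apply. Qed.
Lemma rel0 : r 0 0.
Proof. by rewrite -(subrr 1) -[X in r _ X](subrr 1); apply: relB rel1 rel1. Qed.
Lemma relN a b : r a b -> r (- a) (- b).
Proof. by move=> h; rewrite -[- a]sub0r -[- b]sub0r; apply: relB rel0 h. Qed.
Lemma relD a b a' b' : r a b -> r a' b' -> r (a + a') (b + b').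
Proof. by move=> h h'; rewrite -[a']opprK -[b']opprK; apply/relB/relN. Qed.
Lemma relX a b n : r a b -> r (a ^+ n) (b ^+ n).
Proof.
move=> h; elim: n => [|n IH]; first exact: rel1.
by rewrite !exprS; apply: relM.
Qed.
Lemma rel_prod I (s : seq I) F G : (forall i, r (F i) (G i)) ->
  r (\prod_(i <- s) F i) (\prod_(i <- s) G i).
Proof. by move=> h; apply: big_rec2 => [|i x y _]; [apply: rel1 | apply: relM]. Qed.
Lemma rel_sum I (s : seq I) F G : (forall i, r (F i) (G i)) ->
  r (\sum_(i <- s) F i) (\sum_(i <- s) G i).
Proof. by move=> h; apply: big_rec2 => [|i x y _]; [apply: rel0 | apply: relD]. Qed.
End RingRelations.

Section CoefficientRelation.
Variables (K K' : fieldType) (r : K -> K' -> Prop) (q Z : K) (q' Z' : K').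
Hypothesis rr : ring_rel r.
Hypotheses (rq : r q q') (rqV : r q^-1 q'^-1) (rZ : r Z Z').

Lemma bstep_rel b b' i : (forall j, r (b j) (b' j)) ->
  r (bstep q Z b i) (bstep q' Z' b' i).
Proof.
move=> h; rewrite /bstep; apply: (relD rr).
  apply: (relM rr) (h i); apply: (relD rr); first exact: relX.
  rewrite -!exprVn; apply: (relM rr); last exact: relX.
  by apply: (relM rr) => //; apply: relX.
by case: i => [|i]; [apply: rel0 | apply: (relM rr) => //; apply: relM].
Qed.

Lemma bpair_rel x y x' y' i : r x x' -> r y y' -> r (bpair x y i) (bpair x' y' i).
Proof. by move=> h h'; case: i => [|[|i]] //=; apply: rel0. Qed.

Let rZ1 : r (Z - 1) (Z' - 1).
Proof. by apply: (relB rr) => //; apply: rel1. Qed.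

Lemma bpos_rel n m : r (bpos q Z n m) (bpos q' Z' n m).
Proof.
have rqZ2 : r (q * Z ^+ 2) (q' * Z' ^+ 2) by apply: (relM rr) => //; apply: relX.
suff [] : (forall i, r (bpos q Z n i) (bpos q' Z' n i))
    /\ (forall i, r (bpos q Z n.+1 i) (bpos q' Z' n.+1 i)) by [].
elim: n => [|n [IH IH1]]; last first.
  split=> // i; rewrite !bposSS; apply: (relB rr); first exact: bstep_rel.
  exact: relM.
split=> i; apply: bpair_rel => //; first exact: rel0.
by apply: (relN rr); apply: relM.
Qed.

Lemma bneg_rel n m : r Z^-1 Z'^-1 -> r (bneg q Z n m) (bneg q' Z' n m).
Proof.
move=> rZV; have rqZ2V : r (q * Z ^+ 2)^-1 (q' * Z' ^+ 2)^-1.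
  by rewrite (invfM q) (invfM q') -!exprVn; apply: (relM rr) => //; apply: relX.
suff [] : (forall i, r (bneg q Z n i) (bneg q' Z' n i))
    /\ (forall i, r (bneg q Z n.+1 i) (bneg q' Z' n.+1 i)) by [].
elim: n => [|n [IH IH1]]; last first.
  split=> // i; rewrite !bnegSS; apply: (relM rr) => //.
  by apply: (relB rr) => //; apply: bstep_rel.
by split=> i; apply: bpair_rel => //; [apply: rel0 | apply: rel1].
Qed.

(** The inverse of [Z] enters only through [bneg], which is why negative powers of Q are confined to
    p < 0. Morphisms, specializations and subring membership are all instances of [r]. *)
Lemma ccoef_rel p m : (p < 0 -> r Z^-1 Z'^-1) -> r (ccoef q Z p m) (ccoef q' Z' p m).
Proof.
move=> rZV; rewrite /ccoef; case: eqP => _; first exact: rel1.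
apply: (relM rr).
  apply: (relN rr); case: p rZV => n rZV; first exact: bpos_rel.
  by apply: bneg_rel; apply: rZV.
apply: (rel_prod rr) => j; apply: (relB rr); first exact: rel1.
by rewrite -!exprVn; apply: (relM rr) => //; apply: relX.
Qed.

End CoefficientRelation.

Lemma ccoef_map (K K' : fieldType) (f : {rmorphism K -> K'}) q Z p m :
  f (ccoef q Z p m) = ccoef (f q) (f Z) p m.
Proof.
apply: (ccoef_rel (r := fun x y => f x = y)); rewrite ?fmorphV //.
by split=> [|a b a' b' <- <-|a b a' b' <- <-];
   [apply: rmorph1 | apply: rmorphB | apply: rmorphM].
Qed.

Lemma map_Cpoly (K K' : fieldType) (f : {rmorphism K -> K'}) q Z p :
  map_poly f (Cpoly q Z p) = Cpoly (f q) (f Z) p.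
Proof.
apply/polyP => i; rewrite coef_map /= !coef_poly.
by case: ifP => _; [apply: ccoef_map | apply: rmorph0].
Qed.

Section SpecializedAtOne.
Variables (K : fieldType) (Z X lam : K).
Hypotheses (Z0 : Z != 0) (lamE : Z * lam = 1 + Z ^+ 2 + Z * (1 - Z) * X).

Definition eps1 (m : nat) : K := ((1 - Z) * X) ^+ m.

Lemma eps1S m :
  1 * Z * eps1 m.+1 = (Z * lam - 1 ^+ m - Z ^+ 2 * 1 / 1 ^+ m) * eps1 m.
Proof. by rewrite lamE !expr1n divr1 /eps1 exprS; ring. Qed.

(** At q = 1 each [1 - Z / q^j] is [1 - Z], so the Newton basis becomes the powers of [(1 - Z) X].
    Here [X] is the value of [1/E], and [lamE] is its affine relation with lam. *)
Lemma sum_ccoef p :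
  (Z - 1) * \sum_(m < `|p|.+1) ccoef 1 Z p m * X ^+ m = Phi 1 Z eps1 p.
Proof.
rewrite mulr_sumr; apply: eq_bigr => m _.
rewrite mulrA ccoef_bcoef ?oner_neq0 // -mulrA; congr (_ * _).
rewrite (eq_bigr (fun=> 1 - Z)) => [|j _]; last by rewrite expr1n divr1.
by rewrite prodr_const_nat subn0 /eps1 exprMn.
Qed.

Lemma Phi1_rec p :
  Phi 1 Z eps1 (p + 1) = Z * lam * Phi 1 Z eps1 p - Z ^+ 2 * Phi 1 Z eps1 (p - 1).
Proof. by rewrite (Phi_rec (oner_neq0 _) Z0 eps1S) mul1r. Qed.

End SpecializedAtOne.

(* The extension to p : int by the same recurrence satisfies
   T_(-1-n) = T_n. *)
Fixpoint Tpos (n : nat) : {poly rat} :=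
  match n with
  | 0 => 1
  | 1 => 'X - 1
  | (n2.+1 as n1).+1 => 'X * Tpos n1 - Tpos n2
  end.

Definition Tpoly (p : int) : {poly rat} :=
  match p with Posz n => Tpos n | Negz n => Tpos n end.

Lemma TposSS n : Tpos n.+2 = 'X * Tpos n.+1 - Tpos n.
Proof. by []. Qed.

Lemma Tpoly_rec p : Tpoly (p + 1) = 'X * Tpoly p - Tpoly (p - 1).
Proof.
case: p => [[|n]|[|n]].
- by rewrite add0r sub0r /= mulr1.
- have -> : Posz n.+1 + 1 = n.+2 by rewrite -[n.+2]addn1 PoszD.
  by have -> : Posz n.+1 - 1 = n by rewrite -[n.+1]addn1 PoszD addrK.
- have -> : Negz 0 + 1 = Posz 0 by [].
  have -> : Negz 0 - 1 = Negz 1 by [].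
  by rewrite /Tpoly /=; ring.
have -> : Negz n.+1 + 1 = Negz n by rewrite !NegzE -addn1 PoszD opprD subrK.
have -> : Negz n.+1 - 1 = Negz n.+2 by rewrite !NegzE -[n.+3]addn1 PoszD opprD.
by rewrite /Tpoly TposSS; ring.
Qed.

Lemma size_Tpos n : size (Tpos n) = n.+1.
Proof.
elim/ltn_ind: n => [[|[|n]]] IH; first by rewrite size_poly1.
  by rewrite size_XsubC.
have T0 : Tpos n.+1 != 0 by rewrite -size_poly_gt0 IH.
by rewrite TposSS mulrC size_polyDl size_mulX // ?size_polyN !IH.
Qed.

Lemma Tpos_coprime n : coprimep (Tpos n) (Tpos n.+1).
Proof.
elim: n => [|n IH]; first exact: coprime1p.
rewrite TposSS coprimep_addl_mul -scaleN1r coprimepZr ?oppr_eq0 ?oner_neq0 //.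
by rewrite coprimep_sym.
Qed.

Section PhiT.
Variables (K : fieldType) (f : {rmorphism {poly rat} -> K}) (Z X : K).
Hypotheses (Z0 : Z != 0)
  (lamE : Z * f 'X = 1 + Z ^+ 2 + Z * (1 - Z) * X).

(* At q = 1 the polynomial is linear in Z once lam is the variable. *)
Lemma Phi1_T p :
  Phi 1 Z (eps1 Z X) p = - (Z ^ p * (f (Tpoly p) - Z * f (Tpoly (p - 1)))).
Proof.
apply: (@int_rec_uniq K (Z * f 'X) (Z ^+ 2) (Phi 1 Z (eps1 Z X))
  (fun p => - (Z ^ p * (f (Tpoly p) - Z * f (Tpoly (p - 1)))))).
- by rewrite expf_neq0.
- by move=> i; rewrite (Phi1_rec Z0 lamE).
- move=> i; rewrite addrK Tpoly_rec.
  have -> : Tpoly i = 'X * Tpoly (i - 1) - Tpoly (i - 1 - 1).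
    by rewrite -Tpoly_rec subrK.
  rewrite !rmorphB !rmorphM !expfzDr // expr1z !exprN1.
  by field.
- by rewrite Phi0 //= !rmorph1; ring.
rewrite (Phi1 _ (eps1S lamE)) //.
by rewrite /= rmorphB !rmorph1 expr1z; ring.
Qed.

End PhiT.

(** * Irreducibility at q = 1 *)

Lemma eval_swapXY (k k' : fieldType) (g : {rmorphism k -> k'}) x y
    (B : {poly {poly k}}) :
  (map_poly (horner_eval y \o map_poly g) (swapXY B)).[x]
  = (map_poly (horner_eval x \o map_poly g) B).[y].
Proof.
rewrite !map_poly_comp -swapXY_map -!horner_swapXY swapXYK.
by rewrite horner2_swapXY.
Qed.

(** Modulo [U] only the term i = 0 survives, so [U] divides [A 0], which is too small to be a
    nonzero multiple; then one factor [U] is cancelled. *)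
Lemma homogeneous_eq0 (k : fieldType) (U V : {poly k}) (A : nat -> {poly k}) n :
  coprimep U V -> (forall i, (size (A i) < size U)%N) ->
  \sum_(i < n) A i * (U ^+ i * V ^+ (n.-1 - i)) = 0 ->
  forall i, (i < n)%N -> A i = 0.
Proof.
move=> coUV; elim: n A => [//|n IH] A sA.
have U0 : U != 0 by rewrite -size_poly_gt0 (leq_ltn_trans _ (sA 0%N)).
rewrite big_ord_recl /= subn0 expr0 mul1r => e0.
have eU : \sum_(i < n) A (bump 0 i) * (U ^+ bump 0 i * V ^+ (n - bump 0 i))
    = U * \sum_(i < n) A i.+1 * (U ^+ i * V ^+ (n.-1 - i)).
  rewrite mulr_sumr; apply: eq_bigr => i _.
  by rewrite /bump /= add1n exprS subnS -predn_sub; ring.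
move: e0; rewrite eU => e0.
have A0 : A 0%N = 0.
  have : U %| A 0%N * V ^+ n.
    by move/eqP: e0; rewrite addr_eq0 => /eqP->; rewrite dvdpNr dvdp_mulr.
  rewrite Gauss_dvdpl ?coprimep_expr // => /dvdp_leq h.
  by apply/eqP; apply: contraTT (sA 0%N) => /h; rewrite -leqNgt.
move: e0; rewrite A0 mul0r add0r => /eqP; rewrite mulf_eq0 (negPf U0) /= => /eqP e1.
by case=> [//|i]; rewrite ltnS; apply: (IH (fun i => A i.+1)).
Qed.

Lemma TpolyP n : Tpoly (Posz n) = Tpos n. Proof. by []. Qed.
Lemma TpolyN n : Tpoly (Negz n) = Tpos n. Proof. by []. Qed.

Lemma X0_lam (K : fieldType) (r x : K) : r != 0 -> 1 - r != 0 ->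
  r * x = 1 + r ^+ 2
          + r * (1 - r) * ((r * x - 1 - r ^+ 2) / (r * (1 - r))).
Proof. by move=> r0 r1; field; rewrite r0 r1. Qed.

Lemma horner_revp (K : fieldType) (c : nat -> K) n x : x != 0 ->
  (\poly_(i < n.+1) c (n - i)%N).[x^-1] * x ^+ n = \sum_(i < n.+1) c i * x ^+ i.
Proof.
move=> x0; rewrite horner_poly mulr_suml (reindex_inj rev_ord_inj) /=.
apply: eq_bigr => i _; rewrite subSS subKn ?leq_ord // -mulrA; congr (_ * _).
by have := div_expr_mul 1 x0 (leq_subr i n); rewrite div1r expr1n mul1r subKn ?leq_ord.
Qed.

Lemma X0_affine (K : fieldType) (r x : K) : r != 0 -> 1 - r != 0 ->
  (1 - r)^-1 * x + - (1 + r ^+ 2) / (r * (1 - r))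
  = (r * x - 1 - r ^+ 2) / (r * (1 - r)).
Proof. by move=> r0 r1; field; rewrite r0 r1. Qed.

Lemma horner_map_affine (K K' : fieldType) (f : {rmorphism K -> K'}) a b x :
  (map_poly f (a *: 'X + b%:P)).[x] = f a * x + f b.
Proof.
by rewrite rmorphD /= map_polyZ map_polyX map_polyC hornerD hornerZ hornerX hornerC.
Qed.

Lemma revp_root (K K' : fieldType) (f : {rmorphism K -> K'}) (a : {poly K}) (x : K') n :
  x != 0 -> (size a <= n.+1)%N -> (map_poly f a).[x^-1] = 0 ->
  (map_poly f (\poly_(i < n.+1) a`_(n - i))).[x] = 0.
Proof.
move=> x0 sa e0; have xV0 : x^-1 != 0 by rewrite invr_eq0.
have := horner_revp (fun i => f a`_i) n xV0; rewrite invrK.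
have -> : \sum_(i < n.+1) f a`_i * x^-1 ^+ i = 0.
  rewrite -[RHS]e0 (@horner_coef_wide _ n.+1) ?size_map_poly //.
  by apply: eq_bigr => i _; rewrite coef_map.
move/eqP; rewrite mulf_eq0 expf_eq0 (negPf xV0) andbF orbF => /eqP <-.
congr _.[_]; apply/polyP => i; rewrite coef_map /= !coef_poly.
by case: ifP => _ //; apply: rmorph0.
Qed.

Section Irreducibility.
Variable p : int.
Hypothesis p0 : p <> 0.
Let s := `|p|%N.

(* On the curve T_p - Z T_(p-1) = 0 over Q(lam), Z takes the value rho, and X0 is
   the corresponding value of 1/E. *)
Definition rho : ratfun1 := tofrac (Tpoly p) / tofrac (Tpoly (p - 1)).

Lemma Tpoly_neq0 i : Tpoly i != 0.
Proof. by case: i => n; rewrite -size_poly_gt0 size_Tpos. Qed.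

(* Clearing denominators, the lowest (resp. highest) coefficient of B would be
   divisible by the one of T_p, T_(p-1) that has degree |p|. *)
Lemma rho_eval0 (B : {poly {poly rat}}) :
  (forall i, (size (B`_i)%R <= s)%N) -> (map_poly (@tofrac _) B).[rho] = 0 -> B = 0.
Proof.
move=> sB B0; pose n := size B.
have := homogenize (Tpoly p) (Tpoly_neq0 (p - 1)) (leqnSn n).
rewrite -/rho B0 mul0r => /esym/eqP; rewrite tofrac_eq0 => /eqP e0.
apply/polyP => i; rewrite coef0.
have [le_ni|lt_in] := leqP n i; first by rewrite nth_default.
move: sB e0 p0; rewrite /s; case: p => [[//|m]|m] sB e0 _.
  have ep : m.+1%:Z - 1 = m by rewrite -addn1 PoszD addrK.
  move: e0; rewrite ep !TpolyP => e0.
  apply: (homogeneous_eq0 (n := n.+1) _ _ e0 (leqW lt_in)).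
    by rewrite coprimep_sym Tpos_coprime.
  by move=> j; rewrite size_Tpos ltnS.
have ep : Negz m - 1 = Negz m.+1 by rewrite !NegzE -[m.+2]addn1 PoszD opprD.
(* For p < 0 the polynomial of degree |p| is the denominator of [rho], so the roles of lowest and
   highest coefficient are exchanged. *)
move: e0; rewrite ep !TpolyN (reindex_inj rev_ord_inj) /= => e0.
have e1 : \sum_(j < n.+1) B`_(n - j) * (Tpos m.+1 ^+ j * Tpos m ^+ (n - j)) = 0.
  rewrite -[RHS]e0; apply: eq_bigr => j _; rewrite subSS subKn ?leq_ord //.
  by rewrite [_ * Tpos m.+1 ^+ _]mulrC.
rewrite -(subKn (ltnW lt_in)).
apply: (homogeneous_eq0 (A := fun j => B`_(n - j)) (n := n.+1) _ _ e1).
- by rewrite coprimep_sym Tpos_coprime.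
- by move=> j; rewrite size_Tpos ltnS.
by rewrite ltnS leq_subr.
Qed.

Lemma rho_mul : rho * tofrac (Tpoly (p - 1)) = tofrac (Tpoly p).
Proof. by rewrite /rho divfK // tofrac_eq0 Tpoly_neq0. Qed.

Definition evalrho : {rmorphism {poly rat} -> ratfun1} :=
  horner_eval rho \o map_poly kap.

Lemma rho_transc c : evalrho c = 0 -> c = 0.
Proof.
rewrite /evalrho /= /horner_eval => e0; apply/eqP; rewrite -map_polyC_eq0.
apply/eqP/rho_eval0; last by rewrite -map_poly_comp.
move=> i; rewrite coef_map /= (leq_trans (size_polyC_leq1 _)) // absz_gt0.
exact/eqP.
Qed.

Definition theta := frac_ext_morph rho_transc.

Lemma theta_tofrac c : theta (tofrac c) = (map_poly kap c).[rho].
Proof. exact: (frac_ext_morph_tofrac rho_transc). Qed.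

Lemma theta_var1 : theta var1 = rho.
Proof. by rewrite theta_tofrac map_polyX hornerX. Qed.

Lemma rho_neq0 : rho != 0.
Proof.
apply/eqP => e0; have /eqP : 'X = 0 :> {poly rat}.
  by apply: rho_transc; rewrite /evalrho /= map_polyX /horner_eval hornerX.
by rewrite polyX_eq0.
Qed.

Lemma rho_neq1 : 1 - rho != 0.
Proof.
apply/eqP => e0; have /eqP : 1 - 'X = 0 :> {poly rat}.
  apply: rho_transc; rewrite rmorphB rmorph1 -[RHS]e0.
  by rewrite /evalrho /= map_polyX /horner_eval hornerX.
by rewrite subr_eq0 => /eqP/(congr1 (size \o val)) /=; rewrite size_poly1 size_polyX.
Qed.

(** In other words, lam has degree at least |p| over Q(rho). Once denominators are cleared and the
    variables swapped, this is [rho_eval0]. *)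
Lemma theta_eval0 (a : {poly ratfun1}) :
  (size a <= s)%N -> (map_poly theta a).[var1] = 0 -> a = 0.
Proof.
move=> sa a0.
have [d [B [dn0 eB]]] := clear_denominators a (is_frac_field_tofrac _).
suff B0 : B = 0.
  move/eqP: eB; rewrite B0 rmorph0 scaler_eq0 tofrac_eq0 (negPf dn0).
  by move/eqP.
suff : swapXY B = 0 by move/eqP; rewrite swapXY_eq0 => /eqP.
have sB : (size B <= s)%N.
  have <- : size (map_poly (@tofrac {poly rat}) B) = size B.
    by apply: size_map_inj_poly; [apply/tofrac_inj | apply: rmorph0].
  by rewrite -eB size_scale // tofrac_eq0.
apply: rho_eval0 => [i|].
  apply: leq_trans sB; rewrite -[B in X in (_ <= X)%N]swapXYK -sizeYE.
  exact: max_size_coefXY.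
have /(congr1 (map_poly theta)) := eB.
rewrite map_polyZ => /(congr1 (horner_eval var1)); rewrite /horner_eval hornerZ a0.
rewrite mulr0 -map_poly_comp => /esym.
rewrite (eq_map_poly (g := horner_eval rho \o map_poly kap)) => [e0|c]; last first.
  exact: theta_tofrac.
rewrite (eq_map_poly (g := horner_eval var1 \o map_poly kap)) => [|c]; last first.
  by rewrite /= /horner_eval horner_var1.
by rewrite eval_swapXY e0.
Qed.

Definition X0 : ratfun1 :=
  (rho * var1 - 1 - rho ^+ 2) / (rho * (1 - rho)).

Lemma X0_sum : \sum_(m < s.+1) ccoef 1 rho p m * X0 ^+ m = 0.
Proof.
have r1 : rho - 1 != 0 by rewrite -opprB oppr_eq0 rho_neq1.
have lamE : rho * tofrac 'X = 1 + rho ^+ 2 + rho * (1 - rho) * X0.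
  exact: X0_lam rho_neq0 rho_neq1.
apply: (mulfI r1); rewrite mulr0 (sum_ccoef X0 rho_neq0) (Phi1_T rho_neq0 lamE).
by rewrite rho_mul subrr mulr0 oppr0.
Qed.

Lemma X0_neq0 : X0 != 0.
Proof.
apply/eqP => e0; have := X0_sum; rewrite e0 big_ord_recl big1 => [|i _].
  by rewrite /ccoef /= expr0 addr0 mulr1 => /eqP; rewrite oner_eq0.
by rewrite expr0n /= mulr0.
Qed.

Lemma map_Cpoly_root : (map_poly theta (Cpoly 1 var1 p)).[X0^-1] = 0.
Proof.
have xn0 : X0 ^+ s != 0 by rewrite expf_neq0 // X0_neq0.
apply: (mulIf xn0); rewrite mul0r -[RHS]X0_sum.
rewrite -(horner_revp (ccoef 1 rho p)) ?X0_neq0 // map_Cpoly rmorph1.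
by rewrite theta_var1.
Qed.

(** Reversing [a] moves the root from [1 / X0] to [X0], and the affine polynomial [l], which maps
    lam to [X0], preserves degrees; [theta_eval0] then applies. *)
Lemma theta_X0_eval0 (a : {poly ratfun1}) :
  (size a <= s)%N -> (map_poly theta a).[X0^-1] = 0 -> a = 0.
Proof.
move=> sa a0; pose n := s.-1.
have sE : s = n.+1 by rewrite prednK // absz_gt0; apply/eqP.
pose alpha : ratfun1 := (1 - var1)^-1.
pose beta : ratfun1 := - (1 + var1 ^+ 2) / (var1 * (1 - var1)).
pose l : {poly ratfun1} := alpha *: 'X + beta%:P.
have v1 : 1 - var1 != 0.
  apply/eqP => e; have /eqP := congr1 theta e.
  by rewrite rmorphB rmorph1 rmorph0 theta_var1 (negPf rho_neq1).
have sl : size l = 2%N.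
  rewrite size_polyDl size_scale ?invr_eq0 // size_polyX //.
  exact: leq_ltn_trans (size_polyC_leq1 _) _.
pose a' := \poly_(i < n.+1) a`_(n - i).
have l_X0 : (map_poly theta l).[var1] = X0.
  rewrite horner_map_affine /alpha /beta fmorph_div rmorphN rmorphM rmorphD rmorphXn fmorphV.
  rewrite rmorphB rmorph1 theta_var1; apply: X0_affine; first exact: rho_neq0.
  exact: rho_neq1.
have a'0 : a' = 0.
  apply/eqP; rewrite -(comp_poly2_eq0 a' sl); apply/eqP/theta_eval0.
    rewrite size_comp_poly2 // sE; exact: size_poly.
  rewrite map_comp_poly horner_comp l_X0.
  by apply: revp_root; [exact: X0_neq0 | rewrite -sE | exact: a0].
apply/polyP => i; rewrite coef0.
have [le_si|] := leqP s i; first by rewrite nth_default // (leq_trans sa).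
rewrite sE ltnS => le_in.
by have := coef_poly n.+1 (fun i => a`_(n - i)) (n - i); rewrite -/a' a'0 coef0
  ltnS leq_subr subKn.
Qed.

(** One factor must vanish at the root [1 / X0], whose degree over Q(rho) is at least |p|. *)
Lemma Cpoly_factor (a b : {poly ratfun1}) :
  Cpoly 1 var1 p = a * b -> (s < size a)%N \/ (s < size b)%N.
Proof.
move=> e; have [le_as|] := leqP (size a) s; last by left.
have [le_bs|] := leqP (size b) s; last by right.
have := map_Cpoly_root; rewrite e rmorphM hornerM => /eqP; rewrite mulf_eq0.
have n0 : a * b != 0 by rewrite -e monic_neq0 // Cpoly_monic.
by case/orP => /eqP/theta_X0_eval0 e0; move: n0; rewrite e0 ?mul0r ?mulr0 ?eqxx.
Qed.

End Irreducibility.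

(** * Skew polynomials *)

Section SkewPolynomials.
Variables (K : fieldType) (sg : {rmorphism K -> K}).
Implicit Types A B T : {poly K}.

(* Left multiplication by E. *)
Definition Eop B : {poly K} := map_poly sg B * 'X.

(** The product written as an action of A on B by left multiplications; closure of ideals and orders
    of products then follow by induction on powers of [Eop]. *)
Definition skewm A B : {poly K} := \sum_(i < size A) A`_i *: iter i Eop B.

Lemma Eop0 : Eop 0 = 0.
Proof. by rewrite /Eop rmorph0 mul0r. Qed.

Lemma EopZ c B : Eop (c *: B) = sg c *: Eop B.
Proof. by rewrite /Eop map_polyZ scalerAl. Qed.

Lemma iter_Eop i B : iter i Eop B = \sum_(j < size B) iter i sg B`_j *: 'X^(i + j).
Proof.
elim: i => [|i IH] /=; first by rewrite -[LHS]coefK poly_def.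
rewrite IH /Eop rmorph_sum mulr_suml; apply: eq_bigr => j _ /=.
by rewrite map_polyZ map_polyXn -scalerAl -exprSr.
Qed.

Lemma skewmE A B : skewm A B =
  \sum_(i < size A) \sum_(j < size B) (A`_i * iter i sg B`_j) *: 'X^(i + j).
Proof.
apply: eq_bigr => i _; rewrite iter_Eop scaler_sumr.
by apply: eq_bigr => j _; rewrite scalerA.
Qed.

Lemma skewm_wide n A B : (size A <= n)%N ->
  skewm A B = \sum_(i < n) A`_i *: iter i Eop B.
Proof.
move=> le_An; rewrite /skewm (big_ord_widen n (fun i => A`_i *: iter i Eop B)) //.
rewrite big_mkcond; apply: eq_bigr => i _; case: ltnP => // le_Ai.
by rewrite nth_default // scale0r.
Qed.

Lemma skewmD A A' B : skewm (A + A') B = skewm A B + skewm A' B.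
Proof.
pose n := maxn (size A) (size A').
rewrite (@skewm_wide n (A + A')) ?size_polyD // (@skewm_wide n A) ?leq_maxl //.
rewrite (@skewm_wide n A') ?leq_maxr // -big_split /=.
by apply: eq_bigr => i _; rewrite coefD scalerDl.
Qed.

Lemma skewm_ZXn c n B : skewm (c *: 'X^n) B = c *: iter n Eop B.
Proof.
rewrite (@skewm_wide n.+1); last first.
  by apply: leq_trans (size_scale_leq _ _) _; rewrite size_polyXn.
rewrite big_ord_recr big1 /= => [|i _]; rewrite coefZ coefXn.
  by rewrite eqxx mulr1 add0r.
by rewrite (ltn_eqF (ltn_ord i)) mulr0 scale0r.
Qed.

Lemma skew1m B : skewm 1 B = B.
Proof. by rewrite -[1]scale1r -(expr0 'X) skewm_ZXn /= scale1r. Qed.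

Lemma skew0m B : skewm 0 B = 0.
Proof. by rewrite /skewm size_poly0 big_ord0. Qed.

Lemma size_iter_Eop i B : B != 0 -> size (iter i Eop B) = (i + size B)%N.
Proof.
move=> B0; elim: i => [//|i IH] /=.
by rewrite /Eop size_mulX ?size_map_poly ?IH // map_poly_eq0 -size_poly_gt0 IH
           addn_gt0 size_poly_gt0 B0 orbT.
Qed.

Lemma size_skewm A B : A != 0 -> B != 0 ->
  size (skewm A B) = (size A + size B).-1.
Proof.
move=> A0 B0; have [n sA] : {n | size A = n.+1}.
  by exists (size A).-1; rewrite prednK // size_poly_gt0.
have lA : A`_n != 0.
  by move: A0; rewrite -lead_coef_eq0 lead_coefE sA.
rewrite (@skewm_wide n.+1) ?sA // big_ord_recr /= addrC.
have top : size (A`_n *: iter n Eop B) = (n + size B)%N.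
  by rewrite size_scale // size_iter_Eop.
rewrite size_polyDl ?top // ltnNge; apply/negP => le_top.
have : (n + size B <= (n + size B).-1)%N.
  apply: leq_trans le_top _; apply: leq_trans (size_sum _ _ _) _.
  apply/bigmax_leqP => i _; apply: leq_trans (size_scale_leq _ _) _.
  rewrite size_iter_Eop // -ltnS prednK ?ltn_add2r //.
  by rewrite addn_gt0 size_poly_gt0 B0 orbT.
by rewrite -ltnS prednK ?ltnn // addn_gt0 size_poly_gt0 B0 orbT.
Qed.

(** A field morphism is injective, so [E^k B] has order exactly k more than B and can cancel the
    leading term of T. *)
Lemma skewm_division T B : B != 0 ->
  exists A R, T = skewm A B + R /\ (size R < size B)%N.
Proof.
move=> B0; have [n] := ubnP (size T); elim: n T => // n IH T lt_Tn.
have [lt_TB|le_BT] := ltnP (size T) (size B).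
  by exists 0, T; rewrite skew0m add0r.
pose k := (size T - size B)%N.
have sk : size (iter k Eop B) = size T by rewrite size_iter_Eop // subnK.
pose c := lead_coef T / lead_coef (iter k Eop B).
have T0 : T != 0.
  by rewrite -size_poly_gt0 (leq_trans _ le_BT) // size_poly_gt0.
have lk : lead_coef (iter k Eop B) != 0.
  by rewrite lead_coef_eq0 -size_poly_gt0 sk size_poly_gt0.
have ltT' : (size (T - c *: iter k Eop B)%R < size T)%N.
  have [t st] : {t | size T = t.+1}.
    by exists (size T).-1; rewrite prednK // size_poly_gt0.
  rewrite st ltnS; apply/leq_sizeP => j le_tj.
  rewrite coefB coefZ; move: le_tj; rewrite leq_eqVlt => /orP[/eqP <-|lt_tj].
    have -> : T`_t = lead_coef T by rewrite lead_coefE st.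
    have -> : (iter k Eop B)`_t = lead_coef (iter k Eop B).
      by rewrite lead_coefE sk st.
    by rewrite divfK ?subrr.
  by rewrite !nth_default ?mulr0 ?subrr // ?sk st.
have [A [R [eT sR]]] := IH _ (leq_trans ltT' lt_Tn).
exists (A + c *: 'X^k), R; split=> //.
by rewrite skewmD skewm_ZXn addrAC -eT subrK.
Qed.

End SkewPolynomials.

(** * Specialization at q = 1 *)

Section FractionRelation.
Variables (R : idomainType) (K K' : fieldType).
Variables (h : {rmorphism R -> K}) (ev : {rmorphism R -> K'}) (D : R -> Prop).
Hypotheses (h_inj : forall x, h x = 0 -> x = 0) (D1 : D 1)
  (DM : forall x y, D x -> D y -> D (x * y)) (D0 : forall x, D x -> ev x != 0).

(** The graph of [ev] extended to the localization of [R] at the multiplicative set [D]. *)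
Definition frac_rel (x : K) (y : K') : Prop :=
  exists r d, [/\ D d, x = h r / h d & y = ev r / ev d].

Lemma frac_rel_dom d : D d -> (h d != 0) * (ev d != 0).
Proof.
move=> Dd; split; last exact: D0.
by apply: contra (D0 Dd) => /eqP/h_inj->; rewrite rmorph0.
Qed.

Lemma frac_rel_ring : ring_rel frac_rel.
Proof.
split=> [|x y x' y'|x y x' y'].
- by exists 1, 1; rewrite !rmorph1 !divr1.
- case=> r [d [Dd -> ->]] [r' [d' [Dd' -> ->]]].
  have [hd ed] := frac_rel_dom Dd; have [hd' ed'] := frac_rel_dom Dd'.
  exists (r * d' - r' * d), (d * d'); split; first exact: DM.
    by rewrite rmorphB !rmorphM; field; rewrite hd hd'.
  by rewrite rmorphB !rmorphM; field; rewrite ed ed'.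
case=> r [d [Dd -> ->]] [r' [d' [Dd' -> ->]]].
exists (r * r'), (d * d'); split; first exact: DM.
  by rewrite !rmorphM mulf_div.
by rewrite !rmorphM mulf_div.
Qed.

Lemma frac_rel_emb r : frac_rel (h r) (ev r).
Proof. by exists r, 1; rewrite !rmorph1 !divr1. Qed.

Lemma frac_rel_inv d : D d -> frac_rel (h d)^-1 (ev d)^-1.
Proof. by exists 1, d; rewrite !rmorph1 !div1r. Qed.

Lemma frac_rel_fun x y y' : frac_rel x y -> frac_rel x y' -> y = y'.
Proof.
case=> r [d [Dd -> ->]] [r' [d' [Dd' /eqP e ->]]].
have [hd ed] := frac_rel_dom Dd; have [hd' ed'] := frac_rel_dom Dd'.
apply/eqP; rewrite eqr_div // -!rmorphM; apply/eqP; congr (ev _).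
apply/eqP; rewrite -subr_eq0; apply/eqP/h_inj/eqP.
by rewrite rmorphB !rmorphM subr_eq0 -eqr_div.
Qed.

End FractionRelation.

HB.instance Definition _ := GRing.RMorphism.copy ofZ1
  (@tofrac {poly rat} \o map_poly intr).
HB.instance Definition _ := GRing.RMorphism.copy ofZ2
  (@tofrac {poly ratfun1} \o map_poly ofZ1).

Lemma ofZ1_inj : injective ofZ1.
Proof. by move=> x y /tofrac_inj/(map_inj_poly intr_inj); apply. Qed.

Lemma ofZ2_inj : injective ofZ2.
Proof. by move=> x y /tofrac_inj/(map_inj_poly ofZ1_inj); apply; apply: rmorph0. Qed.

Lemma ofZ2_eq0 c : ofZ2 c = 0 -> c = 0.
Proof. by rewrite -(rmorph0 ofZ2) => /ofZ2_inj. Qed.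

Definition qQ_int : {poly {poly int}} := 'X%:P * 'X.
Definition evZ : {rmorphism {poly {poly int}} -> ratfun1} :=
  ofZ1 \o map_poly (horner_eval (1 : int)).

Lemma ofZ1_X : ofZ1 'X = var1.
Proof. by rewrite /ofZ1 map_polyX. Qed.

Lemma ofZ2_inner : ofZ2 'X%:P = inner.
Proof. by rewrite /ofZ2 map_polyC /= ofZ1_X. Qed.

Lemma ofZ2_outer : ofZ2 'X = outer.
Proof. by rewrite /ofZ2 map_polyX. Qed.

Lemma ofZ2_qQ : ofZ2 qQ_int = inner * outer.
Proof. by rewrite rmorphM /= ofZ2_inner ofZ2_outer. Qed.

Lemma evZ_inner : evZ 'X%:P = 1.
Proof. by rewrite /evZ /= map_polyC /= /horner_eval hornerX rmorph1. Qed.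

Lemma evZ_outer : evZ 'X = var1.
Proof. by rewrite /evZ /= map_polyX ofZ1_X. Qed.

Lemma evZ_qQ : evZ qQ_int = var1.
Proof. by rewrite rmorphM evZ_inner evZ_outer mul1r. Qed.

Lemma ofZ2_qQX N : ofZ2 (qQ_int ^+ N) = (inner * outer) ^+ N.
Proof. by rewrite -ofZ2_qQ; apply: rmorphXn. Qed.

Lemma evZ_qQX N : evZ (qQ_int ^+ N) = var1 ^+ N.
Proof. by rewrite -evZ_qQ; apply: rmorphXn. Qed.

Definition lauZ := frac_rel ofZ2 evZ (fun d => exists N, d = qQ_int ^+ N).

Lemma lauZ_dom d : (exists N, d = qQ_int ^+ N) -> evZ d != 0.
Proof. by case=> N ->; rewrite evZ_qQX expf_neq0 // var1_neq0. Qed.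

Lemma lauZ_ring : ring_rel lauZ.
Proof.
apply: frac_rel_ring; [exact: ofZ2_eq0 | by exists 0%N | | exact: lauZ_dom].
by move=> _ _ [N ->] [M ->]; exists (N + M)%N; rewrite exprD.
Qed.

Lemma lauZP a b : specializes_q1 a b <-> lauZ a b.
Proof.
split=> [[N [r [-> ->]]]|[r [_ [[N ->] -> ->]]]].
  exists r, (qQ_int ^+ N); split; first by exists N.
    by apply: (congr1 (fun x => ofZ2 r / x)); apply: (esym (ofZ2_qQX N)).
  by rewrite evZ_qQX.
exists N, r; split; last by rewrite evZ_qQX.
by apply: (congr1 (fun x => ofZ2 r / x)); apply: ofZ2_qQX.
Qed.

Lemma lauZ_inner : lauZ inner 1.
Proof. by rewrite -ofZ2_inner -evZ_inner; apply: frac_rel_emb; exists 0%N. Qed.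

Lemma lauZ_outer : lauZ outer var1.
Proof. by rewrite -ofZ2_outer -evZ_outer; apply: frac_rel_emb; exists 0%N. Qed.

Lemma lauZ_qQV : lauZ (inner * outer)^-1 var1^-1.
Proof.
by rewrite -ofZ2_qQ -evZ_qQ; apply: frac_rel_inv; exists 1%N; rewrite expr1.
Qed.

(** The denominators of [lauZ] are powers of [q Q] only; 1/q is recovered as [Q / (q Q)], and 1/Q
    likewise. *)
Lemma rel_inv_factor (K K' : fieldType) (r : K -> K' -> Prop) x y x' y' :
  ring_rel r -> x != 0 -> y != 0 -> x' != 0 -> y' != 0 ->
  r y y' -> r (x * y)^-1 (x' * y')^-1 -> r x^-1 x'^-1.
Proof.
move=> rr x0 y0 x0' y0' ry rxy.
have -> : x^-1 = y * (x * y)^-1 by field; rewrite x0 y0.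
have -> : x'^-1 = y' * (x' * y')^-1 by field; rewrite x0' y0'.
exact: relM.
Qed.

Lemma lauZ_innerV : lauZ inner^-1 1^-1.
Proof.
apply: (rel_inv_factor lauZ_ring inner_neq0 outer_neq0 (oner_neq0 _) var1_neq0).
  exact: lauZ_outer.
by have := lauZ_qQV; rewrite -{1}(mul1r var1).
Qed.

Lemma lauZ_outerV : lauZ outer^-1 var1^-1.
Proof.
apply: (rel_inv_factor lauZ_ring outer_neq0 inner_neq0 var1_neq0 (oner_neq0 _)).
  exact: lauZ_inner.
by have := lauZ_qQV; rewrite -{1}(mulr1 var1) mulrC.
Qed.

Definition ev1 : {rmorphism {poly {poly rat}} -> {poly rat}} :=
  map_poly (horner_eval (1 : rat)).

(* Specialization at q = 1, defined on the local ring of Q(q, Q) at q - 1. *)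
Definition spq := frac_rel iota2 (@tofrac {poly rat} \o ev1) (fun d => ev1 d != 0).

Section PolynomialRelation.
Variables (K K' : fieldType) (r : K -> K' -> Prop) (sg : {rmorphism K -> K}).
Hypotheses (rr : ring_rel r) (rsg : forall x y, r x y -> r (sg x) y).

Definition poly_rel (A : {poly K}) (B : {poly K'}) := forall i, r A`_i B`_i.

Lemma poly_relZ c c' A B : r c c' -> poly_rel A B -> poly_rel (c *: A) (c' *: B).
Proof. by move=> rc rA i; rewrite !coefZ; apply: relM. Qed.

Lemma poly_rel_Eop i A B : poly_rel A B -> poly_rel (iter i (Eop sg) A) (B * 'X^i).
Proof.
move=> rA; elim: i => [|i IH] k; first by rewrite mulr1.
rewrite exprSr mulrA /Eop !coefMX; case: k => [|k] /=; first exact: rel0.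
by rewrite coef_map; apply/rsg/IH.
Qed.

(** By [rsg] the twist is invisible after specialization, so the skew product goes to the
    commutative one. *)
Lemma poly_rel_skewm A B A' B' : poly_rel A A' -> poly_rel B B' ->
  poly_rel (skewm sg A B) (A' * B').
Proof.
move=> rA rB; pose n := maxn (size A) (size A').
have -> : A' * B' = \sum_(i < n) A'`_i *: (B' * 'X^i).
  rewrite {1}(_ : A' = \sum_(i < n) A'`_i *: 'X^i).
    by rewrite mulr_suml; apply: eq_bigr => i _; rewrite -scalerAl mulrC.
  rewrite -poly_def; apply/polyP => i; rewrite coef_poly; case: ltnP => // le_ni.
  by rewrite nth_default // (leq_trans _ le_ni) // leq_maxr.
rewrite (@skewm_wide _ _ n) ?leq_maxl // => k; rewrite !coef_sum.
by apply: (rel_sum rr) => i; apply: poly_relZ (rA i) (poly_rel_Eop i rB) k.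
Qed.

End PolynomialRelation.

Lemma spq_dom1 : ev1 1 != 0.
Proof. by rewrite rmorph1 oner_neq0. Qed.

Lemma spq_domM x y : ev1 x != 0 -> ev1 y != 0 -> ev1 (x * y) != 0.
Proof. by move=> x0 y0; rewrite rmorphM mulf_neq0. Qed.

Lemma spq_dom0 x : ev1 x != 0 -> (@tofrac {poly rat} \o ev1) x != 0.
Proof. by rewrite /= tofrac_eq0. Qed.

Lemma iota2_inj0 x : iota2 x = 0 -> x = 0.
Proof. exact: (proj1 is_frac_field_iota2). Qed.

Lemma spq_ring : ring_rel spq.
Proof. exact: (frac_rel_ring iota2_inj0 spq_dom1 spq_domM spq_dom0). Qed.

Lemma spq_emb r : spq (iota2 r) (tofrac (ev1 r)).
Proof.
exact: (@frac_rel_emb _ _ _ iota2 (@tofrac {poly rat} \o ev1)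
          (fun d => ev1 d != 0) spq_dom1 r).
Qed.

Lemma spq_inv d : ev1 d != 0 -> spq (iota2 d)^-1 (tofrac (ev1 d))^-1.
Proof.
exact: (@frac_rel_inv _ _ _ iota2 (@tofrac {poly rat} \o ev1)
          (fun d => ev1 d != 0) d).
Qed.

Lemma spq_fun x y y' : spq x y -> spq x y' -> y = y'.
Proof. exact: (frac_rel_fun iota2_inj0 spq_dom0). Qed.

Definition shift2 : {rmorphism {poly {poly rat}} -> {poly {poly rat}}} :=
  comp_poly ('X%:P * 'X).

Lemma ev1_shift2 r : ev1 (shift2 r) = ev1 r.
Proof.
rewrite /= map_comp_poly rmorphM /= map_polyC map_polyX /=.
by rewrite /horner_eval hornerX mul1r comp_polyXr.
Qed.

Lemma qshiftm_iota2 r : qshiftm (iota2 r) = iota2 (shift2 r).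
Proof.
rewrite [LHS]qshiftm_tofrac /iota2 /= map_comp_poly rmorphM /=.
by rewrite map_polyC map_polyX.
Qed.

Lemma spq_qshift x y : spq x y -> spq (qshiftm x) y.
Proof.
case=> r [d [Dd -> ->]]; exists (shift2 r), (shift2 d); split.
- by rewrite ev1_shift2.
- rewrite fmorph_div.
  exact: (congr2 (fun a b => a / b) (qshiftm_iota2 r) (qshiftm_iota2 d)).
apply: (congr2 (fun a b => tofrac a / tofrac b)); exact: (esym (ev1_shift2 _)).
Qed.

Definition intr2 : {rmorphism {poly {poly int}} -> {poly {poly rat}}} :=
  map_poly (map_poly (intr : int -> rat)).

Lemma iota2_intr2 r : iota2 (intr2 r) = ofZ2 r.
Proof.
by apply: (congr1 (@tofrac {poly ratfun1})); rewrite /= -map_poly_comp.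
Qed.

Lemma ev1_intr2 r : tofrac (ev1 (intr2 r)) = evZ r.
Proof.
apply: (congr1 (@tofrac {poly rat})).
rewrite /= -!map_poly_comp; apply: eq_map_poly => c /=.
by rewrite /horner_eval -(rmorph1 intr) horner_map.
Qed.

Lemma lauZ_spq x y : lauZ x y -> spq x y.
Proof.
case=> r [d [Dd -> ->]]; exists (intr2 r), (intr2 d); split.
- by have := lauZ_dom Dd; rewrite -ev1_intr2 tofrac_eq0.
- exact: (esym (congr2 (fun a b => a / b) (iota2_intr2 r) (iota2_intr2 d))).
exact: (esym (congr2 (fun a b => a / b) (ev1_intr2 r) (ev1_intr2 d))).
Qed.

Definition qm1 : {poly {poly rat}} := ('X - 1)%:P.

Lemma ev1_qm1 : ev1 qm1 = 0.
Proof. by rewrite /= map_polyC /= /horner_eval !hornerE subrr. Qed.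

Lemma qm1_neq0 : qm1 != 0.
Proof. by rewrite polyC_eq0 -size_poly_eq0 size_XsubC. Qed.

Definition div_qm1 : {poly {poly rat}} -> {poly {poly rat}} :=
  map_poly (fun c => c %/ ('X - 1)).

Lemma div_qm1K x : ev1 x = 0 -> qm1 * div_qm1 x = x.
Proof.
move=> e0; apply/polyP => i; rewrite mul_polyC coefZ coef_map_id0 ?div0p //.
rewrite mulrC divpK // -[1]/(1%:P) dvdp_XsubCl.
by have := coef_map (horner_eval (1 : rat)) x i; rewrite -/ev1 e0 coef0 => /esym/eqP.
Qed.

(** Extraction of the (q - 1)-adic content, by repeated exact division. *)
Lemma pull_qm1 (A : {poly {poly {poly rat}}}) : A != 0 ->
  exists l B, A = qm1 ^+ l *: B /\ map_poly ev1 B != 0.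
Proof.
move=> A0.
have step n : (exists l B, A = qm1 ^+ l *: B /\ map_poly ev1 B != 0)
    \/ exists B, A = qm1 ^+ n *: B.
  elim: n => [|n [|[B eB]]]; first by right; exists A; rewrite expr0 scale1r.
    by left.
  have [e0|] := eqVneq (map_poly ev1 B) 0; last by left; exists n, B.
  right; exists (map_poly div_qm1 B); rewrite eB exprSr -scalerA; congr (_ *: _).
  apply/polyP => i; rewrite coefZ coef_map_id0; last by rewrite /div_qm1 map_poly0.
  by rewrite div_qm1K // -coef_map e0 coef0.
have [i Ai] : exists i, A`_i != 0 by exists (size A).-1; rewrite -lead_coefE lead_coef_eq0.
have [j Aij] : exists j, A`_i`_j != 0.
  by exists (size A`_i).-1; rewrite -lead_coefE lead_coef_eq0.
(* A nonzero polynomial in q cannot be divisible by the power of q - 1 whose exponent is its own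
   size. *)
case: (step (size A`_i`_j)) => // -[B eB].
have eAij : A`_i`_j = ('X - 1) ^+ (size A`_i`_j) * B`_i`_j.
  by rewrite {1}eB coefZ -rmorphXn mul_polyC coefZ.
have Bij : B`_i`_j != 0 by apply: contra Aij => /eqP e; rewrite eAij e mulr0.
have := congr1 (size \o val) eAij; rewrite /= mulrC size_Mmonic //; last first.
  by rewrite monic_exp // monicXsubC.
rewrite -[1]/(1%:P) size_exp_XsubC addnS /= => /eqP.
by rewrite -{1}[size _]add0n eqn_add2r eq_sym size_poly_eq0 (negPf Bij).
Qed.

Definition qt : ratfun2 := inner - 1.

Lemma iota2_C c : iota2 c%:P = cst (tofrac c).
Proof. by rewrite /iota2 /= map_polyC. Qed.

Lemma iota2_qm1 : iota2 qm1 = qt.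
Proof.
by rewrite iota2_C (rmorphB (@tofrac {poly rat})) rmorph1 (rmorphB cst) rmorph1.
Qed.

Lemma qt_neq0 : qt != 0.
Proof. by rewrite -iota2_qm1 iota2_eq0 qm1_neq0. Qed.

Lemma rmorph_fix_sub1 (K : fieldType) (f : {rmorphism K -> K}) x :
  f x = x -> f (x - 1) = x - 1.
Proof. by move=> e; rewrite rmorphB rmorph1 e. Qed.

Lemma qshiftm_qt : qshiftm qt = qt.
Proof. exact: rmorph_fix_sub1 qshiftm_inner. Qed.

Lemma spq_qt : spq qt 0.
Proof.
by have := spq_emb qm1; rewrite ev1_qm1 tofrac0 iota2_qm1.
Qed.

Lemma frac_powers (R : idomainType) (K : fieldType) (h : {rmorphism R -> K})
    (h0 : forall x, (h x == 0) = (x == 0)) c d b k l :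
  c != 0 -> d != 0 ->
  h c ^ (k%:Z - l%:Z) * (h (c ^+ l * b) / h (c ^+ k * d)) = (h d)^-1 * h b.
Proof.
move=> c0 d0; have hc : h c != 0 by rewrite h0.
rewrite expfzDr // -exprz_inv -!exprnP exprVn !rmorphM !rmorphXn.
by field; rewrite !expf_neq0 ?hc ?h0 ?d0.
Qed.

(** The exponent is the (q - 1)-adic valuation of the common denominator minus that of the cleared
    numerators. *)
Lemma specialize_poly (A : {poly ratfun2}) : A != 0 ->
  exists e (B : {poly ratfun1}), B != 0 /\ poly_rel spq (qt ^ e *: A) B.
Proof.
move=> A0; have [d [A' [d0 eA]]] := clear_denominators A is_frac_field_iota2.
have A'0 : A' != 0.
  apply: contra A0 => /eqP e; move: eA; rewrite e rmorph0 => /eqP.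
  by rewrite scaler_eq0 (negPf (_ : iota2 d != 0)) ?iota2_eq0.
have dC0 : d%:P != 0 by rewrite polyC_eq0.
have [k [dB [ed dB0]]] := pull_qm1 dC0.
have [l [B [eB B0]]] := pull_qm1 A'0.
pose d' := dB`_0.
have ed' : d = qm1 ^+ k * d' by have := congr1 (coefp 0) ed; rewrite /coefp coefC coefZ.
have dBE : dB = d'%:P.
  apply/size1_polyC; rewrite -(size_scale _ (expf_neq0 k qm1_neq0)) -ed.
  exact: size_polyC_leq1.
have evd' : ev1 d' != 0.
  by move: dB0; rewrite dBE map_polyC polyC_eq0.
pose w : ratfun1 := (tofrac (ev1 d'))^-1.
have w0 : w != 0 by rewrite invr_eq0 tofrac_eq0.
exists (k%:Z - l%:Z), (w *: map_poly (@tofrac _) (map_poly ev1 B)); split.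
  rewrite scaler_eq0 negb_or w0; apply: contra B0 => /eqP e0.
  by apply/eqP/map_tofrac_inj; rewrite e0 rmorph0.
move=> i; rewrite !coefZ !coef_map.
have eAi : A`_i = iota2 A'`_i / iota2 d.
  have := congr1 (coefp i) eA; rewrite /coefp coefZ coef_map /= => <-.
  by rewrite mulrC mulKf // iota2_eq0.
have eA'i : A'`_i = qm1 ^+ l * B`_i by rewrite eB coefZ.
have d'0 : d' != 0 by apply: contra evd' => /eqP->; rewrite rmorph0.
rewrite eAi eA'i ed' -iota2_qm1.
have -> := frac_powers iota2_eq0 B`_i k l qm1_neq0 d'0.
by apply: (relM spq_ring); [apply: spq_inv | apply: spq_emb].
Qed.

(** * The noncommutative polynomial *)

Section FunctionalRelation.
Variables (K K' : fieldType) (r : K -> K' -> Prop).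
Hypotheses (rr : ring_rel r) (rf : forall x y y', r x y -> r x y' -> y = y').

Lemma poly_rel_fun A B B' : poly_rel r A B -> poly_rel r A B' -> B = B'.
Proof. by move=> h h'; apply/polyP => i; apply: rf (h i) (h' i). Qed.

Lemma poly_rel_size A B : poly_rel r A B -> (size B <= size A)%N.
Proof.
move=> h; apply/leq_sizeP => j le_Aj; apply: rf (rel0 rr).
by have := h j; rewrite nth_default.
Qed.

(** Uniqueness of the valuation: e > 0 would force D = 0, and e < 0 would force C = 0. *)
Lemma poly_rel_rescale t e P C D : t != 0 -> r t 0 -> C != 0 -> D != 0 ->
  poly_rel r P C -> poly_rel r (t ^ e *: P) D -> C = D.
Proof.
move=> t0 rt C0 D0 rP rD.
have rtn n : r (t ^+ n.+1) 0 by have := relX rr n.+1 rt; rewrite expr0n.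
case: e rD => [[|n]|n] rD.
- by apply: poly_rel_fun rP _; rewrite expr0z scale1r in rD.
- have := poly_rel_fun (poly_relZ rr (rtn n) rP) rD.
  by rewrite scale0r => e; rewrite -e eqxx in D0.
have := poly_relZ rr (rtn n) rD; rewrite scale0r scalerA NegzE -exprnN.
rewrite mulfV ?expf_neq0 // scale1r => /(poly_rel_fun rP) e.
by rewrite e eqxx in C0.
Qed.

End FunctionalRelation.

Section SkewScale.
Variables (K : fieldType) (sg : {rmorphism K -> K}).

Lemma skewmZ c A B : skewm sg (c *: A) B = c *: skewm sg A B.
Proof.
rewrite (@skewm_wide _ _ (size A)) ?size_scale_leq // scaler_sumr.
by apply: eq_bigr => i _; rewrite coefZ scalerA.
Qed.

Lemma skewm0 A : skewm sg A 0 = 0.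
Proof.
rewrite /skewm big1 // => i _.
have -> : iter i (Eop sg) 0 = 0 by elim: (i : nat) => [//|j /= ->]; apply: Eop0.
by rewrite scaler0.
Qed.

Lemma skewmZr c A B : sg c = c -> skewm sg A (c *: B) = c *: skewm sg A B.
Proof.
move=> sc; rewrite scaler_sumr; apply: eq_bigr => i _.
have -> : iter i (Eop sg) (c *: B) = c *: iter i (Eop sg) B.
  by elim: (i : nat) => [//|j /= ->]; rewrite EopZ sc.
by rewrite !scalerA mulrC.
Qed.

End SkewScale.

Lemma skew_mulE A B : skew_mul A B = skewm qshiftm A B.
Proof.
rewrite skewmE; apply: eq_bigr => i _; apply: eq_bigr => j _.
by congr (_ * _ *: _); apply: eq_iter; apply: qshiftE.
Qed.

(** Q acts as q^n, while [Cpoly] expects Z = q^N with N = n + |p|; hence Z = q^|p| Q. *)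
Definition ncC (p : int) : qWeyl_loc := Cpoly inner (inner ^+ `|p| * outer) p.

Lemma rel_Cpoly (K K' : fieldType) (r : K -> K' -> Prop) q Z q' Z' p :
  ring_rel r -> r q q' -> r q^-1 q'^-1 -> r Z Z' -> (p < 0 -> r Z^-1 Z'^-1) ->
  poly_rel r (Cpoly q Z p) (Cpoly q' Z' p).
Proof.
move=> rr h1 h2 h3 h4 i; rewrite !coef_poly.
by case: ifP => _; [apply: ccoef_rel | apply: rel0].
Qed.

Lemma rel_shifted (K K' : fieldType) (r : K -> K' -> Prop) x y z n :
  ring_rel r -> r x 1 -> r y z -> r (x ^+ n * y) z.
Proof.
move=> rr h1 h2; rewrite -[z]mul1r -(expr1n _ n).
exact: (relM rr (relX rr n h1) h2).
Qed.

Lemma ncC_lauZ p : poly_rel lauZ (ncC p) (Cpoly 1 var1 p).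
Proof.
apply: rel_Cpoly; [exact: lauZ_ring | exact: lauZ_inner | exact: lauZ_innerV | |].
  by apply: rel_shifted; [exact: lauZ_ring | exact: lauZ_inner | exact: lauZ_outer].
move=> _; rewrite invfM -exprVn; apply: rel_shifted; first exact: lauZ_ring.
  by have := lauZ_innerV; rewrite invr1.
exact: lauZ_outerV.
Qed.

Lemma ncC_monic p : ncC p \is monic.
Proof. exact: Cpoly_monic. Qed.

Lemma size_ncC p : size (ncC p) = `|p|.+1.
Proof. exact: size_Cpoly. Qed.

Lemma ncC_neq0 p : ncC p != 0.
Proof. by rewrite -size_poly_eq0 size_ncC. Qed.

Lemma rmorph_fix_expz (K : fieldType) (f : {rmorphism K -> K}) x e :
  f x = x -> f (x ^ e) = x ^ e.
Proof. by move=> h; rewrite fmorphXz h. Qed.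

(* Gauss' lemma at the prime q - 1: a factorization of the noncommutative
   polynomial degenerates to one of its specialization at q = 1. *)
Lemma ncC_factor p A G : p <> 0 -> ncC p = skewm qshiftm A G ->
  (`|p| < size A)%N \/ (`|p| < size G)%N.
Proof.
move=> p0 eP.
have A0 : A != 0.
  by apply/eqP => e; have := ncC_neq0 p; rewrite eP e skew0m eqxx.
have G0 : G != 0.
  by apply/eqP => e; have := ncC_neq0 p; rewrite eP e skewm0 eqxx.
have [e [A1 [A10 rA]]] := specialize_poly A0.
have [e' [G1 [G10 rG]]] := specialize_poly G0.
(* Powers of q - 1 are central in A_loc, so the scaling of the right factor can be moved to the
   front. *)
have fixq := rmorph_fix_expz e' qshiftm_qt.
have := poly_rel_skewm spq_ring spq_qshift rA rG.
rewrite skewmZ skewmZr // -eP scalerA -expfzDr ?qt_neq0 // => rP.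
have C0 : Cpoly 1 var1 p != 0 by rewrite monic_neq0 // Cpoly_monic.
have rC : poly_rel spq (ncC p) (Cpoly 1 var1 p).
  by move=> i; apply/lauZ_spq/ncC_lauZ.
have AG0 : A1 * G1 != 0 by rewrite mulf_neq0.
have eC := poly_rel_rescale spq_ring spq_fun qt_neq0 spq_qt C0 AG0 rC rP.
have sA := poly_rel_size spq_ring spq_fun rA.
have sG := poly_rel_size spq_ring spq_fun rG.
rewrite !size_scale ?expfz_neq0 ?qt_neq0 // in sA sG.
case: (Cpoly_factor p0 eC) => lt_s; [left | right].
  exact: leq_trans lt_s sA.
exact: leq_trans lt_s sG.
Qed.

(** * The annihilator ideal *)

Lemma act_wide n (P : qWeyl) f k : (size P <= n)%N ->
  act P f k = \sum_(j < n) (P`_j).[var1 ^+ k] * f (k + j)%N.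
Proof.
move=> le_Pn; rewrite /act.
rewrite (big_ord_widen n (fun j => (P`_j).[var1 ^+ k] * f (k + j)%N)) //.
rewrite big_mkcond; apply: eq_bigr => i _; case: ltnP => // le_Pi.
by rewrite nth_default // horner0 mul0r.
Qed.

Lemma actD (P P' : qWeyl) f k : act (P + P') f k = act P f k + act P' f k.
Proof.
pose n := maxn (size P) (size P').
rewrite (@act_wide n (P + P')) ?size_polyD // (@act_wide n P) ?leq_maxl //.
rewrite (@act_wide n P') ?leq_maxr // -big_split.
by apply: eq_bigr => j _; rewrite coefD hornerD mulrDl.
Qed.

Lemma actZ c (P : qWeyl) f k : act (c *: P) f k = c.[var1 ^+ k] * act P f k.
Proof.
have le_cP : (size (c *: P) <= size P)%N.
  by apply/leq_sizeP => j le_Pj; rewrite coefZ nth_default ?mulr0.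
rewrite (act_wide _ _ le_cP) mulr_sumr.
by apply: eq_bigr => j _; rewrite coefZ hornerM mulrA.
Qed.

Definition shiftQ : {rmorphism {poly ratfun1} -> {poly ratfun1}} :=
  comp_poly (var1%:P * 'X).

Definition EopW (P : qWeyl) : qWeyl := map_poly shiftQ P * 'X.

Lemma act_EopW P f k : act (EopW P) f k = act P f k.+1.
Proof.
rewrite (@act_wide (size P).+1); last first.
  apply: leq_trans (size_polyMleq _ _) _.
  by rewrite size_polyX addn2 /= ltnS size_poly.
rewrite big_ord_recl coefMX /= horner0 mul0r add0r /act.
apply: eq_bigr => j _; rewrite coefMX /= coef_map /= horner_comp hornerM.
by rewrite hornerC hornerX -exprS /bump /= add1n addnS addSn.
Qed.

Lemma loc_EopW P : loc (EopW P) = Eop qshiftm (loc P).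
Proof.
rewrite /loc /EopW rmorphM /= map_polyX /Eop; congr (_ * _).
rewrite -!map_poly_comp; apply: eq_map_poly => c /=.
by rewrite qshiftm_tofrac.
Qed.

Lemma mul_div_cancel (K : fieldType) (m d n : K) :
  m != 0 -> m * d * (n / m) = n * d.
Proof. by move=> m0; field. Qed.

Section Annihilator.
Variable f : nat -> ratfun1.

(* The left ideal of A_loc generated by the annihilator of f: its elements are
   the left fractions of annihilating operators. *)
Definition inI (T : qWeyl_loc) : Prop :=
  exists (d : {poly ratfun1}) (A : qWeyl),
    [/\ d != 0, annihilator f A & tofrac d *: T = loc A].

Lemma inI_loc A : annihilator f A -> inI (loc A).
Proof. by move=> hA; exists 1, A; rewrite oner_neq0 tofrac1 scale1r. Qed.

Lemma inI0 : inI 0.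
Proof.
rewrite -[0](rmorph0 (map_poly (@tofrac {poly ratfun1}))); apply: inI_loc => n.
by rewrite /act size_poly0 big_ord0.
Qed.

Lemma annihilatorD A B : annihilator f A -> annihilator f B -> annihilator f (A + B).
Proof. by move=> hA hB n; rewrite actD hA hB addr0. Qed.

Lemma annihilatorZ c A : annihilator f A -> annihilator f (c *: A).
Proof. by move=> hA n; rewrite actZ hA mulr0. Qed.

Lemma inID T T' : inI T -> inI T' -> inI (T + T').
Proof.
case=> d [A [d0 hA e]] [d' [A' [d0' hA' e']]].
exists (d * d'), (d' *: A + d *: A'); split; first by rewrite mulf_neq0.
  by apply: annihilatorD; apply: annihilatorZ.
rewrite /loc rmorphD /= !map_polyZ -/(loc A) -/(loc A') -e -e' !scalerA -tofracM.
by rewrite -tofracM scalerDr mulrC [d' * d]mulrC.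
Qed.

Lemma inIZ c T : inI T -> inI (c *: T).
Proof.
case=> d [A [d0 hA e]]; case: (proj2 (is_frac_field_tofrac _) c) => n [m [m0 ->]].
exists (m * d), (n *: A); split; first by rewrite mulf_neq0.
  exact: annihilatorZ.
rewrite /loc map_polyZ -/(loc A) -e !scalerA; congr (_ *: _).
by rewrite tofracM mul_div_cancel // tofrac_eq0.
Qed.

(** Moving E past the denominator shifts it; [shiftQ d] stays nonzero because [qshiftm] is
    injective. *)
Lemma inIE T : inI T -> inI (Eop qshiftm T).
Proof.
case=> d [A [d0 hA e]]; exists (shiftQ d), (EopW A); split.
- by rewrite -(tofrac_eq0 (shiftQ d)) -qshiftm_tofrac fmorph_eq0 tofrac_eq0.
- by move=> n; rewrite act_EopW hA.
by rewrite loc_EopW -e EopZ qshiftm_tofrac.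
Qed.

Lemma inI_skewm A T : inI T -> inI (skewm qshiftm A T).
Proof.
move=> hT; apply: big_ind => [||i _]; [exact: inI0 | exact: inID |].
by apply: inIZ; elim: (i : nat) => //= j; apply: inIE.
Qed.

Lemma inIB T T' : inI T -> inI T' -> inI (T - T').
Proof. by move=> h h'; rewrite -scaleN1r; apply/inID/inIZ. Qed.

Lemma left_ideal_inI T :
  left_ideal (fun B => exists2 A, annihilator f A & B = loc A) T <-> inI T.
Proof.
split=> [|[d [A [d0 hA e]]]].
  elim=> [|A B T' [A' hA' ->] _ IH]; first exact: inI0.
  by apply: inID IH; rewrite skew_mulE; apply/inI_skewm/inI_loc.
have -> : T = skew_mul ((tofrac d)^-1 *: 'X^0) (loc A) + 0.
  by rewrite addr0 skew_mulE skewm_ZXn /= -e scalerA mulVf ?scale1r ?tofrac_eq0.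
by apply: left_idealD; [exists A | apply: left_ideal0].
Qed.

End Annihilator.

Lemma var1X_eq1 i : (0 < i)%N -> 1 - var1 ^+ i != 0.
Proof.
move=> i0; rewrite subr_eq0 eq_sym -subr_eq0 -tofracXn -tofrac1 -tofracB tofrac_eq0.
by rewrite -size_poly_gt0 size_XnsubC.
Qed.

Lemma cyclotomicE p n : cyclotomic p n = cyc var1 p n.
Proof. by []. Qed.

Section Recurrence.
Variables (K : fieldType) (q : K) (p : int).
Hypotheses (q0 : q != 0) (q_nroot : forall i, (0 < i)%N -> 1 - q ^+ i != 0).
Let s := `|p|%N.

(** The factor is the [Z - 1] removed in [ccoef]. It matters for p = 0 and n = 0, where the sum is
    [cyc q 0 0 = 1]. *)
Lemma cyc_rec n :
  (q ^+ (s + n) - 1)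
  * \sum_(j < s.+1) (Cpoly q (q ^+ (s + n)) p)`_j * cyc q p (n + j) = 0.
Proof.
have Z0 : q ^+ (s + n) != 0 by rewrite expf_neq0.
have ann := cyc_annihilated q0 q_nroot (leq_addr n s : `|p| <= s + n)%N.
rewrite -[RHS]ann mulr_sumr (reindex_inj rev_ord_inj).
apply: eq_bigr => m _ /=; rewrite subSS coef_poly ltnS leq_subr.
have le_ms : (m <= s)%N := leq_ord m.
rewrite subKn // mulrA (ccoef_bcoef p m q0 Z0).
by have -> : (n + (s - m) = s + n - m)%N by rewrite addnBA // addnC.
Qed.

(* The trailing coefficient of the recurrence does not vanish, so the sequence
   can be computed backwards. *)
Lemma cyc_back n : p <> 0 ->
  (forall m, (n < m)%N -> cyc q p m = 0) -> cyc q p n = 0.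
Proof.
move=> p0 f0; have s0 : (0 < s)%N by rewrite absz_gt0; apply/eqP.
have z1 : q ^+ (s + n) - 1 != 0.
  by rewrite -opprB oppr_eq0 q_nroot // addn_gt0 s0.
have Z0 : q ^+ (s + n) != 0 by rewrite expf_neq0.
have /eqP := cyc_rec n; rewrite mulf_eq0 (negPf z1) /= big_ord_recl addn0.
rewrite big1 => [|i _]; last by rewrite f0 ?mulr0 // /bump /= addnA addn1 ltnS leq_addr.
rewrite addr0 mulf_eq0 => /orP[|/eqP //].
rewrite coef_poly /= subn0 /ccoef -/s (gtn_eqF s0) mulf_eq0 oppr_eq0 => /orP[/eqP e|].
  by case: p0; apply: bcoef_last q0 Z0 _ e.
rewrite prodf_seq_eq0 => /hasP[j]; rewrite mem_index_iota => /andP[_ lt_js] /=.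
by rewrite -expfB ?(negPf (q_nroot _)) ?subn_gt0 // ltn_addr.
Qed.

End Recurrence.

Section Evaluation.
Variables (K : fieldType) (x : K).

Definition evl := frac_rel (@tofrac {poly K}) (horner_eval x) (fun d => d.[x] != 0).

Let dom1 : (1 : {poly K}).[x] != 0. Proof. by rewrite hornerC oner_neq0. Qed.

Let domM (a b : {poly K}) : a.[x] != 0 -> b.[x] != 0 -> (a * b).[x] != 0.
Proof. by move=> a0 b0; rewrite hornerM mulf_neq0. Qed.

Let tofrac_inj0 (a : {poly K}) : tofrac a = 0 -> a = 0.
Proof. by move/eqP; rewrite tofrac_eq0 => /eqP. Qed.

Lemma evl_ring : ring_rel evl.
Proof. by apply: frac_rel_ring; [apply: tofrac_inj0 | apply: dom1 | apply: domM | ]. Qed.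

Lemma evl_emb c : evl (tofrac c) c.[x].
Proof.
exact: (@frac_rel_emb _ _ _ (@tofrac {poly K}) (horner_eval x)
          (fun d => d.[x] != 0) dom1 c).
Qed.

Lemma evl_inv c : c.[x] != 0 -> evl (tofrac c)^-1 (c.[x])^-1.
Proof.
exact: (@frac_rel_inv _ _ _ (@tofrac {poly K}) (horner_eval x)
          (fun d => d.[x] != 0)).
Qed.

Lemma evl_fun y z z' : evl y z -> evl y z' -> z = z'.
Proof. by apply: frac_rel_fun; [apply: tofrac_inj0 | ]. Qed.

Lemma Cpoly_evl (q : K) m p : q != 0 -> x != 0 ->
  poly_rel evl (Cpoly (tofrac q%:P) (tofrac q%:P ^+ m * tofrac 'X) p)
    (Cpoly q (q ^+ m * x) p).
Proof.
move=> q0 x0.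
have ei : evl (tofrac q%:P) q by have := evl_emb q%:P; rewrite hornerC.
have eiV : evl (tofrac q%:P)^-1 q^-1.
  by have := @evl_inv q%:P; rewrite hornerC; apply.
have eo : evl (tofrac 'X) x by have := evl_emb 'X; rewrite hornerX.
have eoV : evl (tofrac 'X)^-1 x^-1 by have := @evl_inv 'X; rewrite hornerX; apply.
apply: rel_Cpoly; [exact: evl_ring | exact: ei | exact: eiV | |].
  by apply: (relM evl_ring) eo; apply: (relX evl_ring) ei.
move=> _; rewrite !invfM -!exprVn.
by apply: (relM evl_ring) eoV; apply: (relX evl_ring) eiV.
Qed.

End Evaluation.

Section CyclotomicRecurrence.
Variable p : int.
Let s := `|p|%N.
Let f := cyclotomic p.

Lemma ncC_evl n :
  poly_rel (evl (var1 ^+ n)) (ncC p) (Cpoly var1 (var1 ^+ (s + n)) p).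
Proof. by rewrite exprD; apply: Cpoly_evl var1_neq0 (expf_neq0 n var1_neq0). Qed.

Lemma ncC_inI : inI f (ncC p).
Proof.
have [d [A [d0 eA]]] := clear_denominators (ncC p) (is_frac_field_tofrac _).
(* At Q = q^n this is the factor [q^(s+n) - 1] of [cyc_rec]; [d] clears the denominators of the
   coefficients. *)
pose e : {poly ratfun1} := var1 ^+ s *: 'X - 1.
have e0 : e != 0.
  rewrite -size_poly_gt0 /e -[1]/(1%:P) size_polyDl size_scale ?size_polyX //.
  - by rewrite expf_neq0 // var1_neq0.
  - by rewrite size_polyN size_poly1.
  by rewrite expf_neq0 // var1_neq0.
exists (e * d), (e *: A); split; first by rewrite mulf_neq0.
  move=> n; rewrite actZ.
  have sA : (size A <= s.+1)%N.
    have <- : size (map_poly (@tofrac {poly ratfun1}) A) = size A.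
      by apply: size_map_inj_poly; [apply: tofrac_inj | apply: rmorph0].
    by rewrite -eA (leq_trans (size_scale_leq _ _)) // size_ncC.
  rewrite (act_wide _ _ sA).
  have eAj j : (A`_j).[var1 ^+ n]
      = d.[var1 ^+ n] * (Cpoly var1 (var1 ^+ (s + n)) p)`_j.
    apply: (@evl_fun _ (var1 ^+ n) (tofrac A`_j)); first exact: evl_emb.
    have -> : tofrac A`_j = tofrac d * (ncC p)`_j.
      by have := congr1 (coefp j) eA; rewrite /coefp coefZ coef_map.
    by apply: (relM (evl_ring _)); [apply: evl_emb | apply: ncC_evl].
  under eq_bigr => j _ do rewrite eAj -mulrA.
  rewrite -mulr_sumr mulrCA /e hornerD hornerN hornerZ hornerX hornerC -exprD.
  by rewrite [X in _ * X](cyc_rec p var1_neq0 var1X_eq1 n) mulr0.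
by rewrite /loc map_polyZ tofracM -scalerA eA.
Qed.

Lemma cyclotomic0 : f 0 = 1.
Proof. by rewrite /f cyclotomicE; apply: cyc0 var1X_eq1 p. Qed.

Lemma cyclotomic_back n : p <> 0 ->
  (forall m, (n < m)%N -> f m = 0) -> f n = 0.
Proof. exact: (cyc_back var1_neq0 var1X_eq1). Qed.

End CyclotomicRecurrence.

(* For large n the monomials of a(q, q^n) have disjoint degree ranges in q. *)
Lemma horner_var1X_neq0 (a : {poly ratfun1}) : a != 0 ->
  exists N, forall n, (N <= n)%N -> a.[var1 ^+ n] != 0.
Proof.
move=> a0; have [d [A [d0 eA]]] := clear_denominators a (is_frac_field_tofrac _).
have A0 : A != 0.
  apply: contra a0 => /eqP e; move: eA; rewrite e rmorph0 => /eqP.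
  by rewrite scaler_eq0 tofrac_eq0 (negPf d0).
exists (sizeY A) => n le_n; apply/eqP => an0.
have : A.['X^n] = 0.
  apply/eqP; rewrite -tofrac_eq0 -horner_map /= -eA hornerZ tofracXn.
  by rewrite an0 mulr0.
have [J sA] : {J | size A = J.+1}.
  by exists (size A).-1; rewrite prednK // size_poly_gt0.
rewrite horner_coef sA big_ord_recr /= => /eqP; rewrite addrC addr_eq0 => /eqP e.
have AJ : A`_J != 0 by move: A0; rewrite -lead_coef_eq0 lead_coefE sA.
have := congr1 (size \o val) e; rewrite /= size_polyN -exprM size_Mmonic ?monicXn //.
rewrite size_polyXn addnS /= => eS.
have : (size (\sum_(i < J) A`_i * 'X^n ^+ i)%R <= n * J)%N.
  apply: leq_trans (size_sum _ _ _) _; apply/bigmax_leqP => i _.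
  rewrite -exprM; have [->|Ai] := eqVneq A`_i 0; first by rewrite mul0r size_poly0.
  rewrite size_Mmonic ?monicXn // size_polyXn addnS /=.
  apply: leq_trans (_ : n + n * i <= _)%N; last by rewrite -mulnS leq_mul2l ltn_ord orbT.
  by rewrite leq_add2r (leq_trans (max_size_coefXY _ _) le_n).
by rewrite -eS leqNgt -[X in (X < _)%N]add0n ltn_add2r size_poly_gt0 AJ.
Qed.

Lemma cyclotomic_support p (a : {poly ratfun1}) : p <> 0 -> a != 0 ->
  ~ (forall n, a.[var1 ^+ n] * cyclotomic p n = 0).
Proof.
move=> p0 a0 af; have [N aN] := horner_var1X_neq0 a0.
have f0 n : (N <= n)%N -> cyclotomic p n = 0.
  move=> le_Nn; have /eqP := af n.
  by rewrite mulf_eq0 (negPf (aN _ le_Nn)) => /eqP.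
have down k n : (N - k <= n)%N -> cyclotomic p n = 0.
  elim: k n => [|k IH] n; first by rewrite subn0; apply: f0.
  move=> le_n; apply: (cyclotomic_back p0) => m lt_nm; apply: IH.
  apply: leq_trans (leqSpred _) _; rewrite -subnS; exact: leq_ltn_trans le_n lt_nm.
have := cyclotomic0 p; rewrite (down N) ?subnn // => /esym/eqP.
by rewrite oner_eq0.
Qed.

(* A nonzero element R of minimal order right-divides ncC p, hence has order 0
   by [ncC_factor], and then the cyclotomic function would eventually vanish. *)
Lemma inI_small p (R : qWeyl_loc) : (size R <= `|p|)%N -> inI (cyclotomic p) R -> R = 0.
Proof.
have [r] := ubnP (size R); elim: r R => // r IH R lt_Rr le_Rs hR.
apply/eqP; apply/negPn/negP => R0.
have p0 : p <> 0.
  by move=> e; move: le_Rs; rewrite e leqn0 size_poly_eq0 (negPf R0).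
have [A [R' [eP sR']]] := skewm_division qshiftm (ncC p) R0.
have R'0 : R' = 0.
  apply: IH; first exact: leq_trans sR' lt_Rr.
    exact: ltnW (leq_trans sR' le_Rs).
  have -> : R' = ncC p - skewm qshiftm A R by rewrite eP addrC addKr.
  by apply: inIB; [apply: ncC_inI | apply: inI_skewm].
rewrite R'0 addr0 in eP.
have A0 : A != 0.
  by apply/eqP => e; have := ncC_neq0 p; rewrite eP e skew0m eqxx.
have sR1 : size R = 1%N.
  have := congr1 (size \o val) eP; rewrite /= size_ncC size_skewm // => eS.
  have R1 : (0 < size R)%N by rewrite size_poly_gt0.
  case: (ncC_factor p0 eP) => [lt_sA|lt_sR]; last by rewrite ltnNge le_Rs in lt_sR.
  apply/eqP; rewrite eqn_leq R1 andbT -(leq_add2l `|p|) addn1 eS.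
  by rewrite -ltnS prednK ?ltn_add2r // addn_gt0 R1 orbT.
case: hR => d [B [d0 hB eB]].
have RC : R = (R`_0)%:P by apply: size1_polyC; rewrite sR1.
have Rc0 : R`_0 != 0 by move: R0; rewrite {1}RC polyC_eq0.
have eB0 : tofrac B`_0 = tofrac d * R`_0.
  by have := congr1 (coefp 0) eB; rewrite /coefp coefZ coef_map.
have B0 : B`_0 != 0.
  rewrite -(tofrac_eq0 B`_0) eB0; apply: mulf_neq0 Rc0.
  by rewrite tofrac_eq0.
apply: (cyclotomic_support p0 B0) => n; have := hB n.
have sB : (size B <= 1)%N.
  have <- : size (map_poly (@tofrac {poly ratfun1}) B) = size B.
    by apply: size_map_inj_poly; [apply: tofrac_inj | apply: rmorph0].
  by rewrite -[map_poly _ B]eB (leq_trans (size_scale_leq _ _)) // sR1.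
by rewrite (act_wide _ _ sB) big_ord1 addn0.
Qed.

(** The remainder of a right division by [ncC p] stays in the ideal and has order below |p|, so
    [inI_small] kills it. *)
Lemma ncC_characteristic p : characteristic_poly (cyclotomic p) (ncC p).
Proof.
move=> T; rewrite left_ideal_inI; split=> [hT|[A ->]]; last first.
  by rewrite skew_mulE; apply/inI_skewm/ncC_inI.
have [A [R [eT sR]]] := skewm_division qshiftm T (ncC_neq0 p).
exists A; rewrite skew_mulE eT (_ : R = 0) ?addr0 //.
apply: (@inI_small p); first by rewrite size_ncC ltnS in sR.
have -> : R = T - skewm qshiftm A (ncC p) by rewrite eT addrC addKr.
by apply: inIB => //; apply/inI_skewm/ncC_inI.
Qed.

(** Each is a left multiple of the other, so the quotient has order 0; comparing leading
    coefficients shows that it is 1. *)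
Lemma characteristic_poly_uniq f P P' : P \is monic -> P' \is monic ->
  characteristic_poly f P -> characteristic_poly f P' -> P = P'.
Proof.
move=> mP mP' hP hP'.
have [A eA] : exists A, P = skew_mul A P'.
  by apply/hP'/hP; exists 1; rewrite skew_mulE skew1m.
have [A' eA'] : exists A, P' = skew_mul A P.
  by apply/hP/hP'; exists 1; rewrite skew_mulE skew1m.
rewrite skew_mulE in eA; rewrite skew_mulE in eA'.
have P0 := monic_neq0 mP; have P0' := monic_neq0 mP'.
have A0 : A != 0 by apply/eqP => e; move: P0; rewrite eA e skew0m eqxx.
have A0' : A' != 0 by apply/eqP => e; move: P0'; rewrite eA' e skew0m eqxx.
have pos (B : qWeyl_loc) : B != 0 -> (0 < size B)%N by rewrite size_poly_gt0.
have sP : size P = (size A + size P').-1 by rewrite {1}eA size_skewm.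
have sP' : size P' = (size A' + size P).-1 by rewrite {1}eA' size_skewm.
have sA : size A = 1%N.
  move: sP sP' (pos _ A0) (pos _ A0') (pos _ P0) (pos _ P0').
  case: (size A) (size A') (size P) (size P') => [//|a] [//|a'] [//|b] [//|b'].
  rewrite !addSn /= => eb eb' _ _ _ _; apply/eqP; rewrite eqSS -leqn0.
  rewrite eb' in eb.
  by rewrite -(leq_add2r b.+1) add0n [X in (_ <= X)%N]eb leq_add2l leq_addl.
rewrite (size1_polyC (eq_leq sA)) -[_%:P]mulr1 -(expr0 'X) mul_polyC in eA.
rewrite skewm_ZXn /= in eA.
have := congr1 lead_coef eA; rewrite lead_coefZ (monicP mP) (monicP mP') mulr1.
by move=> e; rewrite eA -e scale1r.
Qed.

(** * Comparison with the A-polynomial *)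

(* The twist-knot A-polynomials in the variables (L, N) = (L, M^2). *)
Section HalvedApoly.
Variables (R : comNzRingType) (L N : R).

Definition hsx : R :=
  - L + L ^+ 2 + 2 * L * N + N ^+ 2 + 2 * L * N ^+ 2 + L ^+ 2 * N ^+ 2
  + 2 * L * N ^+ 3 + N ^+ 4 - L * N ^+ 4.

Definition hsy : R := N ^+ 2 * (L + N) ^+ 4.

Fixpoint halfA_pos (n : nat) : R :=
  match n with
  | 0 => 1
  | 1 => L + N ^+ 3
  | 2 => - L ^+ 2 + L ^+ 3 + 2 * L ^+ 2 * N + L * N ^+ 2 + 2 * L ^+ 2 * N ^+ 2
         - L * N ^+ 3 - L ^+ 2 * N ^+ 4 + 2 * L * N ^+ 5 + L ^+ 2 * N ^+ 5
         + 2 * L * N ^+ 6 + N ^+ 7 - L * N ^+ 7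
  | (n2.+1 as n1).+1 => hsx * halfA_pos n1 - hsy * halfA_pos n2
  end.

Fixpoint halfA_neg (n : nat) : R :=
  match n with
  | 0 => 1
  | 1 => - L + L * N + N ^+ 2 + 2 * L * N ^+ 2 + L ^+ 2 * N ^+ 2 + L * N ^+ 3
         - L * N ^+ 4
  | (n2.+1 as n1).+1 => hsx * halfA_neg n1 - hsy * halfA_neg n2
  end.

Definition halfA (p : int) : R :=
  match p with Posz n => halfA_pos n | Negz n => halfA_neg n.+1 end.

Lemma halfA_posSSS n :
  halfA_pos n.+3 = hsx * halfA_pos n.+2 - hsy * halfA_pos n.+1.
Proof. by []. Qed.

Lemma halfA_negSS n : halfA_neg n.+2 = hsx * halfA_neg n.+1 - hsy * halfA_neg n.
Proof. by []. Qed.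

End HalvedApoly.

Lemma halfA_map (R S : comNzRingType) (f : {rmorphism R -> S}) L N p :
  f (halfA L N p) = halfA (f L) (f N) p.
Proof.
have fx : f (hsx L N) = hsx (f L) (f N).
  by rewrite /hsx !(rmorphD, rmorphB, rmorphN, rmorphM, rmorphXn, rmorph1).
have fy : f (hsy L N) = hsy (f L) (f N).
  by rewrite /hsy !(rmorphD, rmorphM, rmorphXn).
have pos n : f (halfA_pos L N n) = halfA_pos (f L) (f N) n.
  elim/ltn_ind: n => [[|[|[|n]]]] IH.
  - exact: rmorph1.
  - by rewrite rmorphD rmorphXn.
  - by rewrite /= !(rmorphD, rmorphB, rmorphN, rmorphM, rmorphXn, rmorph1).
  by rewrite !halfA_posSSS rmorphB (rmorphM f (hsx _ _)) (rmorphM f (hsy _ _)) fx fy !IH.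
have neg n : f (halfA_neg L N n) = halfA_neg (f L) (f N) n.
  elim/ltn_ind: n => [[|[|n]]] IH.
  - exact: rmorph1.
  - by rewrite /= !(rmorphD, rmorphB, rmorphN, rmorphM, rmorphXn, rmorph1).
  by rewrite !halfA_negSS rmorphB (rmorphM f (hsx _ _)) (rmorphM f (hsy _ _)) fx fy !IH.
by case: p => n; [apply: pos | apply: neg].
Qed.

Lemma Apoly_halfA p : Apoly p = halfA 'X ('X%:P ^+ 2) p.
Proof.
have ex : HSx = hsx 'X ('X%:P ^+ 2) by rewrite /HSx /hsx -!exprM.
have ey : HSy = hsy 'X ('X%:P ^+ 2) by rewrite /HSy /hsy -!exprM.
have pos n : Apoly_pos n = halfA_pos 'X ('X%:P ^+ 2) n.
  elim/ltn_ind: n => [[|[|[|n]]]] IH //.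
  - by rewrite /= -!exprM.
  - by rewrite /= -!exprM.
  by rewrite halfA_posSSS -!IH // -ex -ey.
have neg n : Apoly_neg n = halfA_neg 'X ('X%:P ^+ 2) n.
  elim/ltn_ind: n => [[|[|n]]] IH //.
  - by rewrite /= -!exprM.
  by rewrite halfA_negSS -!IH // -ex -ey.
by case: p => n; [apply: pos | apply: neg].
Qed.

Lemma even_poly_compX2 (R : nzRingType) (c : {poly R}) :
  even_poly (c \Po 'X^2) = c.
Proof.
apply/polyP => i; rewrite coef_even_poly coef_comp_poly_Xn //.
by rewrite -muln2 dvdn_mull // mulnK.
Qed.

(** [Apoly p] is the image of the halved polynomial under M -> M^2, a substitution undone by taking
    even parts. *)
Lemma Apoly_sqrtE p : Apoly_sqrt p = halfA 'X 'X%:P p.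
Proof.
rewrite /Apoly_sqrt Apoly_halfA.
pose g : {rmorphism {poly {poly int}} -> {poly {poly int}}} :=
  map_poly (comp_poly 'X^2).
have -> : halfA 'X ('X%:P ^+ 2) p = g (halfA 'X 'X%:P p).
  by rewrite halfA_map /g /= map_polyX map_polyC /= comp_polyX rmorphXn.
apply/polyP => i; rewrite coef_map_id0 ?even_polyC //.
by rewrite /g /= coef_map even_poly_compX2.
Qed.

Lemma ofZ2_Apoly_sqrt p : ofZ2 (Apoly_sqrt p) = halfA outer inner p.
Proof. by rewrite Apoly_sqrtE halfA_map /= ofZ2_inner ofZ2_outer. Qed.

Section EvaluatedCpoly.
Variables (K : fieldType) (L M : K).
Hypotheses (M0 : M != 0) (LM0 : L + M != 0) (nn0 : 1 + L * M != 0).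
Let Z := (1 + L * M) / (L + M).
Let X := L * (M ^+ 2 - 1) ^+ 2 / (M * (L + M) * (1 + L * M)).
Hypothesis Z1 : Z - 1 != 0.
Let Z0 : Z != 0. Proof. by rewrite mulf_neq0 ?invr_eq0. Qed.

Definition wsum (p : int) : K := \sum_(m < `|p|.+1) ccoef 1 Z p m * X ^+ m.

Let a := 1 + Z ^+ 2 + Z * (1 - Z) * X.

Let aE : Z * (a / Z) = 1 + Z ^+ 2 + Z * (1 - Z) * X.
Proof. by rewrite mulrC divfK. Qed.

Lemma wsum_rec p : wsum (p + 1) = a * wsum p - Z ^+ 2 * wsum (p - 1).
Proof.
apply: (mulfI Z1); rewrite mulrBr !(mulrCA (Z - 1)) !(sum_ccoef X Z0).
by rewrite (Phi1_rec Z0 aE) aE.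
Qed.

Lemma wsum0 : wsum 0 = 1.
Proof. by rewrite /wsum big_ord1 /ccoef /= mul1r. Qed.

Lemma wsum1 : wsum 1 = 1 + Z * X.
Proof.
rewrite /wsum big_ord_recl big_ord1 /ccoef /= big_geq //.
by rewrite !mul1r opprK mulr1 expr1.
Qed.

Lemma wsumN1 : wsum (- 1) = 1 - X.
Proof.
rewrite /wsum big_ord_recl big_ord1 /ccoef /= big_geq //.
by rewrite !mul1r mulr1 mulN1r expr1.
Qed.

(** With [t = (1 + LM) / (M (L + M)^3)] one has [a = hsx t] and [Z^2 = hsy t^2], so [wsum_rec] is
    the Hoste-Shanahan recurrence rescaled by powers of t. *)
Lemma wsum_pos n : wsum n.+1 =
  halfA_pos L M n.+1 * (L + M) * ((1 + L * M) / (M * (L + M) ^+ 3)) ^+ n.+1.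
Proof.
have w2 : wsum 2 = a * wsum 1 - Z ^+ 2 * wsum 0.
  by have := wsum_rec 1; rewrite subrr.
(* The induction starts from 1 and 2: at index 0 the formula would give L + M instead of 1. *)
suff H : forall k, wsum k.+1 = halfA_pos L M k.+1 * (L + M)
        * ((1 + L * M) / (M * (L + M) ^+ 3)) ^+ k.+1
     /\ wsum k.+2 = halfA_pos L M k.+2 * (L + M)
        * ((1 + L * M) / (M * (L + M) ^+ 3)) ^+ k.+2.
  by case: (H n).
elim=> [|k [IH IH1]].
  rewrite w2 wsum1 wsum0 /a /Z /X /=.
  by split; field; rewrite M0 LM0 nn0.
split=> //; have := wsum_rec k.+2; have -> : Posz k.+2 + 1 = k.+3.
  by rewrite -[k.+3]addn1 PoszD.
have -> : Posz k.+2 - 1 = k.+1 by rewrite -[k.+2]addn1 PoszD addrK.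
rewrite halfA_posSSS IH IH1 => ->; rewrite /a /Z /X /hsx /hsy.
rewrite !exprS; move: (_ ^+ k) (halfA_pos _ _ _) (halfA_pos _ _ _) => u A B.
by field; rewrite M0 LM0 nn0.
Qed.

(** Downwards the scale is [v = M (L + M) (1 + LM)]: here [a / Z^2 = hsx / v] and
    [1 / Z^2 = hsy / v^2], and the formula is already valid at 0. *)
Lemma wsum_neg n :
  wsum (- n%:Z) = halfA_neg L M n / (M * (L + M) * (1 + L * M)) ^+ n.
Proof.
suff H : forall k, wsum (- k%:Z) = halfA_neg L M k
        / (M * (L + M) * (1 + L * M)) ^+ k
     /\ wsum (- k.+1%:Z) = halfA_neg L M k.+1
        / (M * (L + M) * (1 + L * M)) ^+ k.+1.
  by case: (H n).
elim=> [|k [IH IH1]].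
  rewrite oppr0 wsum0 wsumN1 /X /=.
  by split; field; rewrite ?oner_neq0 ?M0 ?LM0 ?nn0.
split=> //; have := wsum_rec (- k.+1%:Z).
have -> : - k.+1%:Z + 1 = - k%:Z by rewrite -addn1 PoszD opprD subrK.
have -> : - k.+1%:Z - 1 = - k.+2%:Z by rewrite -[k.+2]addn1 PoszD opprD.
rewrite IH IH1 halfA_negSS => e.
apply: (mulfI (expf_neq0 2 Z0)).
have -> : Z ^+ 2 * wsum (- k.+2%:Z) = a * wsum (- k.+1%:Z) - wsum (- k%:Z).
  by rewrite IH IH1 e; ring.
rewrite IH IH1 /a /Z /X /hsx /hsy !exprS.
have v0 : (M * (L + M) * (1 + L * M)) ^+ k != 0 by rewrite expf_neq0 ?mulf_neq0.
move: (_ ^+ k) v0 (halfA_neg _ _ _) (halfA_neg _ _ _) => u v0 A B.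
by field; rewrite v0 M0 LM0 nn0.
Qed.

Lemma wsum_closed p : wsum p = halfA L M p *
  (if 0 < p then (1 + L * M) ^ p / (M ^ p * (L + M) ^ (3 * p - 1))
   else ((M * (L + M) * (1 + L * M)) ^+ `|p|%N)^-1).
Proof.
case: p => [[|n]|n].
- by rewrite wsum0 /= expr0 invr1 mulr1.
- rewrite wsum_pos ltz_nat /= -mulrA; congr (_ * _).
  have -> : 3 * n.+1%:Z - 1 = (3 * n + 2)%N.
    by rewrite -[n.+1]addn1 PoszD [Posz (_ + 2)]PoszD PoszM; ring.
  rewrite -!exprnP expr_div_n exprMn -exprM.
  have -> : (3 * n.+1 = (3 * n + 2) + 1)%N by rewrite mulnS; ring.
  rewrite [(L + M) ^+ (_ + 1)]exprD expr1.
  have M1 : M ^+ n.+1 != 0 by rewrite expf_neq0.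
  have LM1 : (L + M) ^+ (3 * n + 2) != 0 by rewrite expf_neq0.
  move: (M ^+ n.+1) ((L + M) ^+ (3 * n + 2)) ((1 + _) ^+ _) M1 LM1 => u v w u0 v0.
  by field; rewrite u0 v0 LM0.
by rewrite {1}NegzE wsum_neg.
Qed.

End EvaluatedCpoly.

(** * The C-polynomial *)

Notation twistC p := (Cpoly 1 var1 p).

Lemma C_polynomialP p C : C_polynomial p C <-> C = twistC p.
Proof.
split=> [[P [mP hP sP]]|->]; last first.
  exists (ncC p); split; [exact: ncC_monic | exact: ncC_characteristic |].
  by move=> j; apply/lauZP/ncC_lauZ.
have eP := characteristic_poly_uniq mP (ncC_monic p) hP (ncC_characteristic p).
apply: (poly_rel_fun spq_fun (A := P)) => j; apply: lauZ_spq.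
  exact/lauZP/sP.
by rewrite eP; apply: ncC_lauZ.
Qed.

Lemma op_twistC p : op (twistC p) = \poly_(j < `|p|.+1) ccoef 1 var1 p j.
Proof.
rewrite /op size_Cpoly; apply/polyP => j; rewrite !coef_poly /=.
by case: ltnP => // le_j; rewrite ltnS leq_subr subKn.
Qed.

Lemma horner_map_op_twistC (K : fieldType) (f : {rmorphism ratfun1 -> K}) p x :
  (map_poly f (op (twistC p))).[x]
  = \sum_(m < `|p|.+1) ccoef 1 (f var1) p m * x ^+ m.
Proof.
have -> : map_poly f (op (twistC p)) = \poly_(j < `|p|.+1) ccoef 1 (f var1) p j.
  rewrite op_twistC; apply/polyP => j; rewrite coef_map /= !coef_poly.
  by case: ifP => _; [rewrite ccoef_map rmorph1 | apply: rmorph0].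
by rewrite horner_poly.
Qed.

Lemma eval1_XsubC1 u : eval1 u ('X - 1) = u - 1.
Proof. by rewrite rmorphB rmorph1 /= map_polyX /horner_eval hornerX. Qed.

Lemma phiQ_neq1 : phiQ - 1 != 0.
Proof.
apply/eqP => e; have /eqP : 'X - 1 = 0 :> {poly rat}.
  by apply: phiQ_transc; rewrite eval1_XsubC1 e.
by rewrite -size_poly_eq0 size_XsubC.
Qed.

Lemma phi_op_twistC p : phi (tofrac (op (twistC p))) =
  ofZ2 (Apoly_sqrt p) *
  (if 0 < p then (1 + outer * inner) ^ p
                 / (inner ^ p * (outer + inner) ^ (3 * p - 1))
   else ((inner * (outer + inner) * (1 + outer * inner)) ^+ `|p|%N)^-1).
Proof.
rewrite phimE /phim subst2m_tofrac horner_map_op_twistC subst1m_var1 ofZ2_Apoly_sqrt.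
exact: (wsum_closed inner_neq0 add_outer_inner_neq0 one_add_mul_neq0 phiQ_neq1).
Qed.

(** A factor of full degree leaves a constant cofactor. Since the product is monic, the inverse of
    that constant is the leading coefficient of the other factor, which lies in S. *)
Lemma twistC_irreducible_in (S : {poly ratfun1} -> Prop) p : p <> 0 ->
  S (twistC p) -> (forall a, S a -> S (lead_coef a)%:P) ->
  irreducible_in S (twistC p).
Proof.
move=> p0 SC Sl; have s0 : (0 < `|p|)%N by rewrite absz_gt0; apply/eqP.
have C0 : twistC p != 0 by rewrite monic_neq0 // Cpoly_monic.
have small a b : S a -> S b -> twistC p = a * b -> (`|p| < size a)%N ->
    unit_in S b.
  move=> Sa Sb e lt_a.
  have ab0 : a * b != 0 by rewrite -e.
  have [a0 b0] : a != 0 /\ b != 0 by apply/andP; rewrite -negb_or -mulf_eq0.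
  have b1 : (size b <= 1)%N.
    have := congr1 (size \o val) e; rewrite /= size_Cpoly size_mul // => es.
    rewrite -(leq_add2l (size a)) -subn1 addn1 in es *.
    rewrite -ltnS -(prednK (_ : 0 < size a + size b)%N) ?ltnS; last first.
      by rewrite addn_gt0 size_poly_gt0 a0.
    by rewrite -subn1 -es.
  split=> //; exists (lead_coef a)%:P; first exact: Sl.
  have /(congr1 lead_coef) := e; rewrite lead_coefM (monicP (Cpoly_monic _ _ _)).
  by rewrite [b]size1_polyC // lead_coefC -polyCM mulrC => <-.
split=> //; first exact/eqP.
  case=> _ [y _ /(congr1 (size \o val))]; rewrite /= size_poly1.
  have [->|y0] := eqVneq y 0; first by rewrite mulr0 size_poly0.
  rewrite size_mul // size_Cpoly addSn /= => e.
  by have := leq_add s0 (_ : 0 < size y)%N; rewrite e size_poly_gt0 => /(_ y0).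
move=> a b Sa Sb e; case: (Cpoly_factor p0 e) => lt_s.
  by right; apply: (small a b).
by left; apply: (small b a) => //; rewrite mulrC.
Qed.

Lemma polyEQ_coef (C : {poly ratfun1}) :
  (forall i, exists c : {poly rat}, C`_i = tofrac c) -> polyEQ C.
Proof.
elim/poly_ind: C => [_|A c IH hC]; first by exists 0; rewrite rmorph0.
have [a eA] : polyEQ A.
  by apply: IH => i; have [x ex] := hC i.+1; exists x; rewrite -ex coefD coefMX coefC addr0.
have [x ex] := hC 0%N; rewrite coefD coefMX coefC add0r in ex.
exists (a * 'X + x%:P); rewrite rmorphD rmorphM /= map_polyX map_polyC -eA.
by congr (_ + _%:P).
Qed.

Lemma laurentEQ_coef (C : {poly ratfun1}) :
  (forall i, exists N (c : {poly rat}), var1 ^+ N * C`_i = tofrac c) -> laurentEQ C.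
Proof.
move=> hC; have [N hN] : exists N, forall i, (i < size C)%N ->
    exists c : {poly rat}, var1 ^+ N * C`_i = tofrac c.
  elim: (size C) => [|n [N IH]]; first by exists 0%N.
  have [M [c ec]] := hC n; exists (N + M)%N => i.
  rewrite ltnS leq_eqVlt => /orP[/eqP ->|/IH [x ex]].
    by exists ('X^N * c); rewrite exprD -mulrA ec tofracM tofracXn.
  by exists ('X^M * x); rewrite addnC exprD -mulrA ex tofracM tofracXn.
exists N; apply: polyEQ_coef => i; rewrite coefZ.
have [/hN //|le_Ci] := ltnP i (size C).
by exists 0; rewrite nth_default // mulr0 tofrac0.
Qed.

(** Membership in Q[Q] is encoded as a ring relation that ignores its second argument, so that
    [rel_Cpoly] applies with dummy values on the right. *)
Lemma twistC_polyEQ p : 0 < p -> polyEQ (twistC p).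
Proof.
move=> p0; apply: polyEQ_coef.
pose r (x y : ratfun1) := exists c : {poly rat}, x = tofrac c.
have rr : ring_rel r.
  split=> [|x y x' y' [c ->] [c' ->]|x y x' y' [c ->] [c' ->]].
  - by exists 1; rewrite tofrac1.
  - by exists (c - c'); rewrite tofracB.
  by exists (c * c'); rewrite tofracM.
have r1 : r 1 1 by apply: rel1.
apply: (rel_Cpoly (q' := 1) (Z' := 1) rr r1); first by rewrite !invr1.
  by exists 'X.
by rewrite ltNge ltW.
Qed.

Lemma twistC_laurentEQ p : laurentEQ (twistC p).
Proof.
apply: laurentEQ_coef.
pose r (x y : ratfun1) := exists N (c : {poly rat}), var1 ^+ N * x = tofrac c.
have rr : ring_rel r.
  split=> [|x y x' y' [N [c e]] [N' [c' e']]|x y x' y' [N [c e]] [N' [c' e']]].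
  - by exists 0%N, 1; rewrite tofrac1 mulr1.
  - exists (N + N')%N, ('X^N' * c - 'X^N * c').
    by rewrite tofracB !tofracM !tofracXn -e -e' exprD -/var1; ring.
  by exists (N + N')%N, (c * c'); rewrite tofracM -e -e' exprD; ring.
have r1 : r 1 1 by apply: rel1.
apply: (rel_Cpoly (q' := 1) (Z' := 1) rr r1); first by rewrite !invr1.
  by exists 0%N, 'X; rewrite mul1r.
by move=> _; exists 1%N, 1; rewrite expr1 mulfV ?var1_neq0 // tofrac1.
Qed.

Lemma polyEQ_lead C : polyEQ C -> polyEQ (lead_coef C)%:P.
Proof.
case=> c ->; apply: polyEQ_coef => i; rewrite coefC; case: eqP => _.
  by rewrite lead_coefE coef_map; eexists.
by exists 0; rewrite tofrac0.
Qed.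

Lemma laurentEQ_lead C : laurentEQ C -> laurentEQ (lead_coef C)%:P.
Proof.
case=> N /polyEQ_lead; rewrite lead_coefZ => h.
by exists N; rewrite -mul_polyC -polyCM.
Qed.

Theorem theorem3 :
  (forall p : int, exists! C, C_polynomial p C) /\
  (forall (p : int) (C : {poly ratfun1}), C_polynomial p C ->
     let L := outer in
     let M := inner in
     phi (tofrac (op C)) =
       ofZ2 (Apoly_sqrt p) *
       (if 0 < p
        then (1 + L * M) ^ p / (M ^ p * (L + M) ^ (3 * p - 1))
        else ((M * (L + M) * (1 + L * M)) ^+ `|p|%N)^-1)) /\
  (forall (p : int) (C : {poly ratfun1}), p <> 0 -> C_polynomial p C ->
     irreducible_in (if 0 < p then polyEQ else laurentEQ) C).
Proof.
split; [move=> p | split=> [p C /C_polynomialP -> | p C p0 /C_polynomialP ->]].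
- exists (twistC p); split; first exact/C_polynomialP.
  by move=> C /C_polynomialP.
- exact: phi_op_twistC.
apply: twistC_irreducible_in => //.
  by case: ifP => [/twistC_polyEQ|_] //; apply: twistC_laurentEQ.
by case: ifP => _ a; [apply: polyEQ_lead | apply: laurentEQ_lead].
Qed.
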